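(* For every fixed integer $k\ge 3$ there is a constant $c(k)>0$, depending only on $k$, such that the following holds. Let $G$ be a connected graph with $m$ edges and minimum degree at least $2$ that contains none of the cycles $C_4$, $C_6$, $C_{2k}$ as a subgraph. Then $G$ admits a bisection of size at least \[\frac{m}{2}+c(k)\, m^{(2k+1)/(2k+2)}.\]
   Context: $C_\ell$ denotes the cycle of length $\ell$. A bisection of a graph $G$ is a partition $(V_0,V_1)$ of $V(G)$ into two disjoint sets with $\big||V_0|-|V_1|\big|\le 1$; its size is the number of edges of $G$ with one endpoint in $V_0$ and the other in $V_1$. *)

(* Defs.v *)
From mathcomp Require Import all_boot all_order all_algebra.
From mathcomp Require Import all_classical all_reals all_analysis.
Set Implicit Arguments.
Unset Strict Implicit.
Unset Printing Implicit Defensive.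
Import Order.TTheory GRing.Theory Num.Theory.

Local Open Scope nat_scope.

(* A finite graph is given by its vertex set [T : finType] and its adjacency
   relation [e : rel T]. *)
Section Graphs.
Variables (T : finType) (e : rel T).

Definition simple_graph : Prop := symmetric e /\ irreflexive e.

Definition connected_graph : Prop :=
  0 < #|T| /\ forall x y : T, connect e x y.

Definition degree (x : T) : nat := #|[pred y | e x y]|.

Definition min_degree_ge (d : nat) : Prop := forall x : T, d <= degree x.

Definition edges : {set {set T}} :=
  [set E : {set T} | [exists x, exists y, e x y && (E == [set x; y])]]%SET.

(* The vertices of the cycle are listed in cyclic order; this is the cycle of
   length [l] only for [3 <= l], since [ucycle e [:: x; y]] just says that
   [x] and [y] are adjacent. *)
Definition contains_cycle (l : nat) : Prop :=
  exists s : seq T, size s = l /\ ucycle e s.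

Definition bisection (V0 V1 : {set T}) : Prop :=
  [/\ V0 :|: V1 = finset.setT, [disjoint V0 & V1]
    & (`|#|V0|%:Z - #|V1|%:Z| <= 1)%R]%SET.

Definition cut_size (V0 V1 : {set T}) : nat :=
  #|[set E in edges | [exists x in V0, exists y in V1, E == [set x; y]]]%SET|.

End Graphs.

(* Main.v *)
(* Fix a maximal matching, with vertex set [M] and independent complement [W].
   Giving the ends of every matching edge opposite signs balances [M] and gains on
   the matching edges themselves; three ways of choosing the signs gain more.
   - With random signs on [M], pair up [W] and place each pair greedily.  The
     fourth moment method gives a gain of order [sqrt (degree w)] for [w] in [W]:
     without 4-cycles the two vertices of a pair share at most one neighbour.
   - Let a random half of the matching edges follow the majority of a few
     neighbours in the other half.  Without 4- and 6-cycles every edge lies in a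
     bounded number of triangles of matching edges, so after deleting conflicting
     neighbours all other edges stay uncorrelated, and each [x] in [M] gains a
     constant times the square root of its degree inside [M].  [W] is then placed
     greedily.
   - Do the same with random signs on [W], so that [x] gains a constant times
     [sqrt (degree x)], and repair the imbalance of [W], which is of order
     [sqrt #|W|], by flipping vertices of [W] of small degree.
   A graph without [C_2k] is [D]-degenerate with [D = O(m^(1/(k+1)))], since the
   breadth-first search levels in a subgraph of large minimum degree grow by a
   factor of order [D].  Removing vertices of degree at most [D] one by one shows
   that the square roots of the degrees sum to at least [m / sqrt D], and one of
   the three gains is of this order, which is [m^((2k+1)/(2k+2))]: the repair is too
   expensive only if [#|W| = O(D)], and then there are at most [#|M| + #|W|^2] edges
   between [M] and [W], because a graph without 4-cycles has codegrees at most 1. *)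
Require Import Defs.
From mathcomp Require Import all_boot all_order all_algebra.
From mathcomp Require Import zify ring lra.
From mathcomp Require boolp.
Set Implicit Arguments.
Unset Strict Implicit.
Unset Printing Implicit Defensive.
Import Order.TTheory GRing.Theory Num.Theory.
Local Open Scope nat_scope.

(** * Even-cycle-free graphs are degenerate *)

Definition degree_in (T : finType) (g : rel T) (S : {set T}) (v : T) : nat :=
  #|[set y in S | g v y]|.

Lemma big_setU_disjoint (R : Type) (idx : R) (op : Monoid.com_law idx)
    (T : finType) (A B : {set T}) (F : T -> R) : [disjoint A & B] ->
  \big[op/idx]_(x in A :|: B) F x =
  op (\big[op/idx]_(x in A) F x) (\big[op/idx]_(x in B) F x).
Proof. by move=> disj; rewrite -bigU //; apply: eq_bigl => x; rewrite !inE. Qed.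

Section Degeneracy.
Variables (T : finType) (g : rel T).
Hypotheses (gsym : symmetric g) (girr : irreflexive g).

Lemma degree_in_sum (S : {set T}) v : degree_in g S v = \sum_(y in S) g v y.
Proof.
rewrite /degree_in -sum1_card big_mkcond [RHS]big_mkcond /=.
by apply: eq_bigr => y _; rewrite inE; case: (y \in S); case: (g v y).
Qed.

Lemma degree_inS (S S' : {set T}) v :
  S \subset S' -> degree_in g S v <= degree_in g S' v.
Proof.
move=> sub; apply/subset_leq_card/subsetP => y; rewrite !inE => /andP[yS ->].
by rewrite (subsetP sub).
Qed.

Lemma sum_degree_inD1 (S : {set T}) v : v \in S ->
  \sum_(u in S) degree_in g S u =
  \sum_(u in S :\ v) degree_in g (S :\ v) u + (degree_in g S v).*2.
Proof.
move=> vS; rewrite (big_setD1 v) //=.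
have eqd : \sum_(u in S :\ v) degree_in g S u =
  \sum_(u in S :\ v) (degree_in g (S :\ v) u + g v u).
  apply: eq_bigr => u _; rewrite !degree_in_sum (big_setD1 v) //= addnC.
  by rewrite gsym.
rewrite eqd big_split /= [in degree_in g S v]degree_in_sum.
by rewrite (big_setD1 v) //= girr; lia.
Qed.

(** Remove the vertices given by the hypothesis one by one. Each removal lowers the degree sum by
    twice the current degree of the vertex, and monotonicity bounds that degree by [Phi] of the
    original one. A constant [Phi] counts edges; a square root gives sums of square roots of
    degrees. *)
Lemma degenerate_sum_bound (R : realDomainType) (Phi : nat -> R) (S : {set T}) :
  {homo Phi : a b / a <= b >-> (a <= b)%R} ->
  (forall S' : {set T}, S' \subset S -> S' != set0 ->
     exists2 v, v \in S' &
       ((degree_in g S' v)%:R <= Phi (degree_in g S' v))%R) ->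
  ((\sum_(v in S) degree_in g S v)%:R <=
   2%:R * \sum_(v in S) Phi (degree_in g S v))%R.
Proof.
move=> Phi_mono; have [n] := ubnP #|S|; elim: n S => // n IHn S leSn Sdeg.
have [->|S_neq0] := eqVneq S set0; first by rewrite !big_set0 mulr0.
have [v vS dv] := Sdeg S (subxx _) S_neq0.
have le_IH := IHn (S :\ v).
have {le_IH}/le_IH le_IH : #|S :\ v| < n.
  by have := cardsD1 v S; rewrite vS; lia.
have {}le_IH : ((\sum_(u in S :\ v) degree_in g (S :\ v) u)%:R <=
    2%:R * \sum_(u in S :\ v) Phi (degree_in g (S :\ v) u))%R.
  apply: le_IH => S' sS'.
  by apply: Sdeg; apply: (subset_trans sS'); exact: subsetDl.
rewrite (sum_degree_inD1 vS) natrD [X in (_ <= _ * X)%R](big_setD1 v) //=.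
rewrite mulrDr addrC.
apply: lerD.
  by rewrite -muln2 natrM mulrC ler_wpM2l.
apply: (le_trans le_IH); rewrite ler_wpM2l //; apply: ler_sum => u _.
by apply: Phi_mono; apply: degree_inS; apply: subsetDl.
Qed.

(** The current vertex joins the forbidden set [X] at every step while [n] drops by one, so a fresh
    neighbour always remains. *)
Lemma greedy_path (S : {set T}) d :
  (forall v, v \in S -> d <= degree_in g S v) ->
  forall n (X : {set T}) v, v \in S -> #|X| + n < d ->
  exists p, [/\ size p = n, path g v p, uniq (v :: p),
    {subset p <= S} & forall y, y \in p -> y \notin X].
Proof.
move=> Sdeg; elim=> [|n IHn] X v vS Xn; first by exists [::].
have /card_gt0P[w] : 0 < #|[set y in S | g v y] :\: (v |: X)|.
  have := cardsID (v |: X) [set y in S | g v y]; have := Sdeg v vS.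
  have := subset_leq_card (subsetIr [set y in S | g v y] (v |: X)).
  by rewrite /degree_in cardsU1; case: (v \in X) => /=; lia.
rewrite !inE negb_or => /andP[/andP[wv wX] /andP[wS gvw]].
have [|p [sp pp up pS pX]] := IHn (v |: X) w wS.
  by rewrite cardsU1; case: (v \in X) => /=; lia.
exists (w :: p); split => //=; rewrite ?sp ?gvw //.
- rewrite inE negb_or eq_sym wv /=; move: up => /= ->; rewrite andbT.
  by apply/negP => /pX; rewrite !inE eqxx.
- by move=> y; rewrite inE => /orP[/eqP->//|/pS].
- move=> y; rewrite inE => /orP[/eqP->//|/pX].
  by rewrite !inE negb_or => /andP[].
Qed.

End Degeneracy.

(** * Cycles through two consecutive levels of a rooted tree *)

Section Layers.
Variables (T : finType) (e : rel T) (L : nat -> {set T}) (par : T -> T) (x : T).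
Hypotheses (esym : symmetric e).
Hypothesis L0 : L 0 = [set x].
Hypothesis Ldisj : forall i j y, y \in L i -> y \in L j -> i = j.
Hypothesis parP : forall i y, y \in L i.+1 -> par y \in L i /\ e y (par y).

Lemma iter_par_level i t y : t <= i -> y \in L i -> iter t par y \in L (i - t).
Proof.
elim: t i y => [|t IHt] i y ti yL; first by rewrite subn0.
case: i => // i in ti yL *; rewrite iterS.
have := IHt i.+1 y; rewrite ltnW // => /(_ isT yL).
have -> : i.+1 - t = (i - t).+1 by lia.
by case/parP.
Qed.

Lemma path_traject_par i h y : h <= i -> y \in L i ->
  path e y (traject par (par y) h).
Proof.
elim: h i y => [|h IHh] [|i] y //= hi yL.
have [pyL ->] := parP yL; exact: IHh pyL.
Qed.

Lemma traject_par_level i h y z : h <= i -> y \in L i ->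
  z \in traject par (par y) h ->
  exists t, [/\ 0 < t, t <= h, z = iter t par y & z \in L (i - t)].
Proof.
move=> hi yL /trajectP[t th ->]; exists t.+1; rewrite -iterSr; split => //.
by apply: iter_par_level => //; lia.
Qed.

Lemma uniq_traject_par i h y : h <= i -> y \in L i ->
  uniq (traject par (par y) h).
Proof.
elim: h i y => [|h IHh] [|i] y //= hi yL.
have [pyL _] := parP yL; rewrite (IHh i) // andbT.
have {}hi : h <= i by [].
by apply/negP => /(traject_par_level hi pyL)[t [t0 th _ /(Ldisj pyL)]]; lia.
Qed.

Section DenseLayer.
Variables (k i : nat) (g : rel T) (Y Z : {set T}).
Hypotheses (gsym : symmetric g) (ge : subrel g e).
Hypotheses (YL : Y \subset L i) (ZL : Z \subset L i.+1) (ik : i < k).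
Hypothesis gYZ : forall u v, g u v -> (u \in Y) && (v \in Z) || (u \in Z) && (v \in Y).
Hypothesis gdeg : forall v, v \in Y :|: Z -> 2 * k <= degree_in g (Y :|: Z) v.

Let YZ v : v \in Y -> v \in Z -> False.
Proof. by move=> /(subsetP YL) vi /(subsetP ZL) /(Ldisj vi); lia. Qed.

Let gY u v : u \in Y -> g u v -> v \in Z.
Proof. by move=> uY /gYZ /orP[/andP[]//|/andP[/(YZ uY)]]. Qed.

Let gZ u v : u \in Z -> g u v -> v \in Y.
Proof. by move=> uZ /gYZ /orP[/andP[/YZ/(_ uZ)]|/andP[]]. Qed.

Let coherent h := [forall z in Z, forall y in Y, forall y' in Y,
  g z y ==> g z y' ==> (iter h par y == iter h par y')].

Let coherentP h : reflect (forall z y y', z \in Z -> g z y -> g z y' ->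
  iter h par y = iter h par y') (coherent h).
Proof.
apply: (iffP idP) => [co z y y' zZ gzy gzy'|co].
  move/forall_inP: co => /(_ z zZ) /forall_inP /(_ y (gZ zZ gzy)).
  by move=> /forall_inP /(_ y' (gZ zZ gzy')); rewrite gzy gzy' => /eqP.
apply/forall_inP => z zZ; apply/forall_inP => y _; apply/forall_inP => y' _.
by apply/implyP => gzy; apply/implyP => gzy'; apply/eqP; apply: co gzy gzy'.
Qed.

(** Two steps along the path go through some [z] of [Z], and [coherent h] gives both neighbours the
    same [h]-th ancestor. *)
Let even_path h p y : coherent h -> y \in Y -> path g y p -> ~~ odd (size p) ->
  last y p \in Y /\ iter h par (last y p) = iter h par y.
Proof.
move=> /coherentP co; have [n] := ubnP (size p).
elim: n p y => // n IHn [|z [|y' p]] y //= sp yY /and3P[gyz gzy' pp] ev.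
have zZ := gY yY gyz; have y'Y := gZ zZ gzy'.
have [||lY ->] := IHn p y' _ y'Y pp; [lia | by rewrite negbK in ev|].
by split => //; apply: co gzy' _ => //; rewrite gsym.
Qed.

(* Let [h] be least such that the neighbours of every [z \in Z] have a common
   [h]-th ancestor.  Some [z] has neighbours [y1], [y'] whose [h.-1]-st ancestors
   differ; extend a third neighbour [y2] of [z] to a path of length [2k - 2h - 2]
   ending at [u].  The [h.-1]-st ancestor of [u] differs from that of [y1] or of
   [y'], and the tree paths from that vertex and from [u] close a [2k]-cycle. *)
Lemma dense_layer_cycle : Y :|: Z != set0 -> contains_cycle e (2 * k).
Proof.
move=> YZ0.
have gT v : degree_in g (Y :|: Z) v = #|[set y | g v y]|.
  rewrite /degree_in; apply: eq_card => y; rewrite !inE.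
  by case: (boolP (g v y)) => [/gYZ|]; rewrite ?andbF // andbT; do 4 case: (_ \in _).
have [z0 z0Z] : exists z, z \in Z.
  have [v] := set0Pn _ YZ0; rewrite inE => /orP[vY|]; last by exists v.
  have : 0 < #|[set y | g v y]| by rewrite -gT (leq_trans _ (gdeg _)) ?inE ?vY //; move: ik; clear; lia.
  by case/card_gt0P => w; rewrite inE => /(gY vY); exists w.
have h_le : exists2 h, coherent h & h <= i.
  exists i => //; apply/coherentP => z y y' zZ gzy gzy'.
  have root w : g z w -> iter i par w = x.
    move=> /(gZ zZ) /(subsetP YL) /(iter_par_level (leqnn i)).
    by rewrite subnn L0 inE => /eqP.
  by rewrite !root.
have ex_h : exists h, coherent h by case: h_le => h; exists h.
case: (ex_minnP ex_h) => h co_h h_min.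
have hi : h <= i by case: h_le => h' /h_min hh' h'i; apply: leq_trans h'i.
have degZ z : z \in Z -> 2 * k <= #|[set y | g z y]|.
  by move=> zZ; rewrite -gT gdeg // inE zZ orbT.
have h0 : 0 < h.
  rewrite lt0n; apply/eqP => h0; move: co_h; rewrite h0 => /coherentP /= co.
  have : 1 < #|[set y | g z0 y]| by apply: leq_trans (degZ z0 z0Z); move: ik; clear; lia.
  case/card_gt1P => y [y' [gy gy' /eqP]]; case; move: gy gy'; rewrite !inE => gy gy'.
  exact: co gy gy'.
have : ~~ coherent h.-1 by apply/negP => /h_min; move: h0; clear; lia.
rewrite negb_forall_in => /exists_inP[z zZ]; rewrite negb_forall_in.
case/exists_inP => y1 y1Y; rewrite negb_forall_in => /exists_inP[y' y'Y].
rewrite !negb_imply => /and3P[gzy1 gzy' anc_neq].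
have [y2] : exists y, y \in [set y | g z y] :\: [set y1; y'].
  apply/card_gt0P; have := cardsID [set y1; y'] [set y | g z y]; have := degZ z zZ.
  have := subset_leq_card (subsetIr [set y | g z y] [set y1; y']).
  by rewrite cards2; case: (_ != _); move: ik h0 hi; clear; lia.
rewrite !inE negb_or => /andP[/andP[y2y1 y2y'] gzy2].
have y2Y := gZ zZ gzy2.
(* At most 3 forbidden vertices and [2 * k - 2 * h - 2] steps: the total is below [2 * k] because
   [h] is positive. *)
have [||p [sp pp up pS pX]] :=
  greedy_path gdeg (n := 2 * k - 2 * h - 2) (X := [set z; y1; y']) (v := y2).
- by rewrite inE y2Y.
- have : #|[set z; y1; y']| <= 3.
    rewrite (leq_trans (leq_card_setU _ _)) // cards1 cards2.
    by case: (_ != _).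
  by move: h0 hi ik; clear; lia.
set u := last y2 p.
have [uY anc_u] : u \in Y /\ iter h par u = iter h par y2.
  by apply: even_path co_h y2Y pp _; rewrite sp; move: h0 hi ik; clear; lia.
have [a [aY gza anc_au aX]] : exists a, [/\ a \in Y, g z a,
    iter h.-1 par a != iter h.-1 par u & a \in [set y1; y']].
  have [e1|ne1] := eqVneq (iter h.-1 par y1) (iter h.-1 par u).
    by exists y'; rewrite -e1 eq_sym !inE eqxx orbT.
  by exists y1; rewrite !inE eqxx.
have anc_a : iter h par a = iter h par u.
  by rewrite anc_u; move/coherentP: co_h => co; apply: co gza gzy2.
have aL := subsetP YL _ aY; have uL := subsetP YL _ uY.
have zL := subsetP ZL _ zZ.
(* The tree path from [a] stops just below the common ancestor, which ends the tree path from [u].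
   With [a], [z], [y2] the cycle has [3 + (2 * k - 2 * h - 2) + h + (h - 1)] vertices. *)
pose s2 := traject par (par a) h.-1.
have def_s2 : rcons s2 (iter h par a) = traject par (par a) h.
  have -> : h = h.-1.+1 by move: h0; clear; lia.
  by rewrite trajectSr -iterSr.
pose q := z :: y2 :: p ++ traject par (par u) h.
have lastq : last a q = iter h par a.
  by rewrite /q /= last_cat last_traject -/u anc_a.
exists (a :: q ++ rev s2); split.
  by rewrite /= size_cat size_rev /= size_cat !size_traject sp; move: h0 hi ik; clear; lia.
have a_neq_y2 : a != y2.
  by move: aX; rewrite !inE => /orP[]/eqP->; rewrite eq_sym.
have low v : v \in Y :|: Z -> exists2 j, i <= j & v \in L j.
  rewrite inE => /orP[/(subsetP YL) vL|/(subsetP ZL) vL]; first by exists i.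
  by exists i.+1.
have not_low v w t : v \in Y :|: Z -> w \in L (i - t) -> 0 < t <= i -> v != w.
  move=> /low[j ij vj] wL ti; apply/eqP => vw; move: vj; rewrite vw.
  by move=> /(Ldisj wL); move: ij ti; clear; lia.
have traj_up y v n : y \in L i -> n <= i -> v \in Y :|: Z ->
    v \notin traject par (par y) n.
  move=> yL ni vYZ; apply/negP => /(traject_par_level ni yL)[t [t0 th _ vL]].
  by have := not_low v v t vYZ vL; rewrite eqxx => /(_ _)/negP; apply => //; move: t0 th ni; clear; lia.
have hi' : h.-1 <= i by move: hi; clear; lia.
rewrite /ucycle; apply/andP; split.
  rewrite (cycle_path a) /= last_cat.
  suff : path e a (q ++ rcons (rev s2) a).
    rewrite -[rcons _ a]cats1 catA cat_path /= => /andP[pq].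
    rewrite last_cat andbT => -> /=.
    by move: pq; rewrite /q /=.
  rewrite cat_path lastq; apply/andP; split.
    rewrite /q /= cat_path -/u !ge ?(path_traject_par hi uL) //; last by rewrite gsym.
    by rewrite andbT (sub_path ge).
  have -> : rcons (rev s2) a = rev (belast a (rcons s2 (iter h par a))).
    by rewrite belast_rcons rev_cons.
  have {1}-> : iter h par a = last a (rcons s2 (iter h par a)) by rewrite last_rcons.
  rewrite rev_path def_s2 (eq_path (e' := e)); last by move=> ? ?; rewrite esym.
  exact: path_traject_par aL.
have aYZ : a \in Y :|: Z by rewrite inE aY.
have zYZ : z \in Y :|: Z by rewrite inE zZ orbT.
have y2YZ : y2 \in Y :|: Z by rewrite inE y2Y.
have az : a != z by apply/eqP => az; apply: (YZ aY); rewrite az.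
have y2z : y2 != z by apply/eqP => yz; apply: (YZ y2Y); rewrite yz.
have pnot w : w \in [set z; y1; y'] -> w \notin p.
  by move=> wX; apply/negP => /pX; rewrite wX.
have anotp : a \notin p.
  by apply: pnot; move: aX; rewrite !inE => /orP[]->; rewrite ?orbT.
have znotp : z \notin p by apply: pnot; rewrite !inE eqxx.
move: up => /= /andP[y2p up].
rewrite /q /= !inE !mem_cat !mem_rev !negb_or az a_neq_y2 anotp znotp y2p.
rewrite (eq_sym z) y2z !traj_up //=.
rewrite !cat_uniq up (uniq_traject_par hi uL) rev_uniq (uniq_traject_par hi' aL).
rewrite !andbT /=; apply/andP; split.
  by apply/hasPn => v vt; apply/negP => /pS /(traj_up u v h uL hi); rewrite vt.
apply/hasPn => v; rewrite mem_rev mem_cat negb_or.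
move=> /[dup] vt /(traject_par_level hi' aL)[t [t0 th vt' vL]].
apply/andP; split.
  by apply/negP => /pS /(traj_up a v h.-1 aL hi'); rewrite vt.
(* By its level, a vertex on both tree paths has the same height above [a] and [u], so their
   [h.-1]-st ancestors would agree. *)
apply/negP => /(traject_par_level hi uL)[t' [t'0 t'h vt'' vL']].
have tt' : t = t' by have := Ldisj vL vL'; move: t'h th hi; clear; lia.
move/eqP: anc_au; apply.
have -> : h.-1 = h.-1 - t + t by move: th; clear; lia.
have eq_anc : iter t par a = iter t par u by rewrite -vt' [in RHS]tt' -vt''.
by rewrite !iterD eq_anc.
Qed.
End DenseLayer.
End Layers.

(** * Growth of breadth-first search levels in a bipartite graph *)

Section BondySimonovits.
Variables (T : finType) (e f : rel T) (col : T -> bool) (k q : nat) (U : {set T}).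
Hypotheses (esym : symmetric e) (fsym : symmetric f) (fe : subrel f e).
Hypothesis fcol : forall x y, f x y -> col y = ~~ col x.
Hypothesis fU : forall x y, f x y -> y \in U.
Hypothesis fdeg : forall x, x \in U -> 2 * k * (q + 3) <= #|[set y | f x y]|.
Hypotheses (k0 : 0 < k) (q0 : 0 < q).
Hypothesis C2k_free : ~ contains_cycle e (2 * k).

Section Rooted.
Variable x : T.
Hypothesis xU : x \in U.

Let grow (S : {set T}) := S :|: [set y | [exists z in S, f z y]].
Let ball i := iter i grow [set x].
Let level i := if i is j.+1 then ball j.+1 :\: ball j else ball 0.
Let ball_sub i j : i <= j -> ball i \subset ball j.
Proof.
move=> /subnK <-; elim: (j - i) => [|n IHn] //.
by apply: (subset_trans IHn); rewrite addSn /ball iterS subsetUl.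
Qed.

Let level_ball i : level i \subset ball i.
Proof. by case: i => [|i] //=; apply: subsetDl. Qed.

Let ballS i y z : z \in ball i -> f z y -> y \in ball i.+1.
Proof.
by move=> zi fzy; rewrite /ball iterS !inE; apply/orP; right; apply/exists_inP; exists z.
Qed.

Let level_disj i j y : y \in level i -> y \in level j -> i = j.
Proof.
wlog lij : i j / i < j => [H yi yj|].
  by case: (ltngtP i j) => // lt; [apply: H|symmetry; apply: H].
case: j lij => // j lij /(subsetP (level_ball i)) yi.
by rewrite /level inE (subsetP (ball_sub (i := i) (j := j) lij) _ yi).
Qed.

Let level_pred i y : y \in level i.+1 -> exists2 z, z \in level i & f z y.
Proof.
rewrite /level inE {2}/ball iterS -/(ball i) !inE => /andP[yi /orP[|]].
  by rewrite (negbTE yi).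
case/exists_inP => z zi fzy; exists z => //.
case: i zi yi => [|i] //= zi yi; rewrite inE zi andbT.
by apply: contra yi => zi'; apply: ballS fzy.
Qed.

Let exists_par : exists par : T -> T, forall i y, y \in level i.+1 ->
  par y \in level i /\ e y (par y).
Proof.
suff H y : exists z, forall i, y \in level i.+1 -> z \in level i /\ e y z.
  by have [par parP] := fin_all_exists H; exists par => i y; apply: parP.
have [[i yi]|no_i] := boolp.EM (exists i, y \in level i.+1).
  have [z zi fzy] := level_pred yi; exists z => j yj.
  have [->] : j.+1 = i.+1 by apply: level_disj yi.
  by split => //; apply: fe; rewrite fsym.
by exists y => i yi; case: no_i; exists i.
Qed.

Let level_col i y : y \in level i -> col y = odd i (+) col x.
Proof.
elim: i y => [|i IHi] y; first by rewrite /= inE => /eqP->.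
by case/level_pred => z /IHi zi /fcol ->; rewrite zi /=; case: odd; case: col.
Qed.

Let levelU i : level i \subset U.
Proof.
case: i => [|i]; first by rewrite /= sub1set.
by apply/subsetP => y /level_pred[z _ /fU].
Qed.

(** Colours alternate from level to level, which rules out edges inside a level. *)
Let level_succ i y z : y \in level i -> f y z ->
  z \in level i.+1 \/ (0 < i) && (z \in level i.-1).
Proof.
move=> yi fyz; have zi := ballS (subsetP (level_ball i) _ yi) fyz.
have [zi'|zi'] := boolP (z \in ball i); last by left; rewrite /level inE zi zi'.
right; case: i yi zi zi' => [|i] yi _ zi.
  by move: yi zi; rewrite /= !inE => /eqP yx /eqP zx; move: (fcol fyz); rewrite yx zx; case: col.
have zNi : z \notin level i.+1.
  apply/negP => /level_col zc; move: (fcol fyz); rewrite zc (level_col yi).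
  by case: (_ (+) _).
have {zNi} : z \in ball i by move: zNi; rewrite /level inE zi andbT negbK.
case: i yi {zi} => [|i] yi // zi /=; rewrite inE zi andbT.
apply/negP => zi'; rewrite fsym in fyz; have := ballS zi' fyz.
by move: yi; rewrite /= inE => /andP[/negP].
Qed.

(** Every nonempty subset of the two levels has a vertex of inner degree below [2 * k], as otherwise
    [dense_layer_cycle] yields a forbidden cycle. Degeneracy then bounds the number of edges. *)
Let layer_bound i : i < k ->
  \sum_(y in level i) #|[set z in level i.+1 | f y z]| <=
  2 * k * (#|level i| + #|level i.+1|).
Proof.
move=> ik; pose S := level i :|: level i.+1.
have firr : irreflexive f by move=> y; apply/negP => /fcol; case: col.
have dis y : y \in level i -> y \notin level i.+1.
  by move=> yi; apply/negP => /(level_disj yi); lia.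
have same_col j y z : y \in level j -> z \in level j -> ~~ f y z.
  move=> yj zj; apply/negP => /fcol; rewrite (level_col yj) (level_col zj).
  by case: (_ (+) _).
have sumS : \sum_(v in S) degree_in f S v <= 2 * (2 * k * #|S|).
  have : ((\sum_(v in S) degree_in f S v)%:R <=
      2%:R * \sum_(v in S) (2 * k)%:R :> int)%R.
    apply: (@degenerate_sum_bound _ f fsym firr int (fun=> (2 * k)%:R%R)) => // S' sS' S'0.
    suff /exists_inP[v vS' dv] : [exists v in S', degree_in f S' v < 2 * k].
      by exists v => //; rewrite ler_nat ltnW.
    apply: contraT; rewrite negb_exists_in => /forall_inP S'deg; case: C2k_free.
    have [par parP] := exists_par.
    pose Y := S' :&: level i; pose Z := S' :&: level i.+1.
    have defS' : Y :|: Z = S' by rewrite -setIUr; apply/setIidPl.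
    apply: (@dense_layer_cycle T e level par x esym _ level_disj parP k i
      [rel u v | [&& u \in S', v \in S' & f u v]] Y Z).
    - by [].
    - by move=> u v /=; rewrite fsym; case: (u \in S'); case: (v \in S').
    - by move=> u v /= /and3P[_ _ /fe].
    - exact: subsetIr.
    - exact: subsetIr.
    - exact: ik.
    - move=> u v /and3P[uS' vS' fuv]; rewrite !in_setI uS' vS' !andTb.
      have := subsetP sS' _ uS'; have := subsetP sS' _ vS'; rewrite !in_setU.
      move=> /orP[vi|vi] /orP[ui|ui].
      + by have := same_col _ _ _ ui vi; rewrite fuv.
      + by rewrite ui vi orbT.
      + by rewrite ui vi.
      + by have := same_col _ _ _ ui vi; rewrite fuv.
    - rewrite defS' => v vS'; rewrite leqNgt.
      suff -> : degree_in [rel u v | [&& u \in S', v \in S' & f u v]] S' v =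
        degree_in f S' v by apply: S'deg.
      by apply: eq_card => y; rewrite !inE /= vS'; case: (y \in S').
    - by rewrite defS'.
  by rewrite sumr_const -[X in (_ <= _ * X)%R]mulr_natr -!natrM ler_nat.
have disj : [disjoint level i & level i.+1].
  by rewrite disjoint_subset; apply/subsetP => y /dis.
have cardS : #|S| = #|level i| + #|level i.+1|.
  by rewrite cardsU disjoint_setI0 // cards0 subn0.
have bsum : \sum_(v in S) degree_in f S v =
    (\sum_(y in level i) #|[set z in level i.+1 | f y z]|).*2.
  have self j v : v \in level j -> \sum_(y in level j) f v y = 0.
    by move=> vj; apply: big1 => y yj; rewrite (negbTE (same_col _ _ _ vj yj)).
  have dS v : degree_in f S v = \sum_(y in level i) f v y + \sum_(y in level i.+1) f v y.
    by rewrite degree_in_sum (big_setU_disjoint _ _ disj) /=.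
  rewrite (big_setU_disjoint _ _ disj) /= -addnn; congr (_ + _).
    by apply: eq_bigr => y yi; rewrite dS self // -degree_in_sum.
  under eq_bigr => y yi do rewrite dS [X in _ + X]self // addn0.
  rewrite exchange_big /=; apply: eq_bigr => y yi.
  by rewrite -/(degree_in f _ y) degree_in_sum; apply: eq_bigr => z _; rewrite fsym.
by rewrite bsum cardS in sumS; move: sumS; clear; lia.
Qed.

Let layer_sym i : \sum_(y in level i.+1) #|[set z in level i | f y z]| =
  \sum_(y in level i) #|[set z in level i.+1 | f y z]|.
Proof.
under eq_bigr => y _ do rewrite -/(degree_in f _ y) degree_in_sum.
under [RHS]eq_bigr => y _ do rewrite -/(degree_in f _ y) degree_in_sum.
by rewrite exchange_big /=; do 2 apply: eq_bigr => ? _; rewrite fsym.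
Qed.

(** Let [c], [a], [b] be the sizes of three consecutive levels. Edges leave the middle one only
    forwards or backwards, so [layer_bound] and the minimum degree give
    [(q + 3) * a <= (a + b) + (c + a)]; induction gives [c <= a], hence the 3. *)
Let level_growth i : i < k -> q * #|level i| <= #|level i.+1|.
Proof.
elim: i => [|i IHi] ik.
  have l0 : level 0 = [set x] by [].
  have := layer_bound ik; rewrite l0 big_set1 cards1.
  have -> : #|[set z in level 1 | f x z]| = #|[set y | f x y]|.
    apply: eq_card => z; rewrite !inE; case: (boolP (f x z)) => fxz; rewrite ?andbF //.
    have xl : x \in level 0 by rewrite /= inE.
    by have [|//] := level_succ xl fxz; rewrite /level !inE => ->.
  have := fdeg xU; move: #|[set y | _]| #|level 1| k0 => d c; clear.
  by rewrite muln1 => k0 dk dc; rewrite -(leq_pmul2l (m := 2 * k)) ?muln_gt0 //; lia.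
have /IHi IH : i < k by exact: ltnW.
have b1 := layer_bound ik; have b2 := layer_bound (ltnW ik).
have : 2 * k * (q + 3) * #|level i.+1| <=
  \sum_(y in level i.+1) #|[set z in level i.+2 | f y z]| +
  \sum_(y in level i.+1) #|[set z in level i | f y z]|.
  rewrite mulnC -sum_nat_const -big_split; apply: leq_sum => y yi.
  apply: leq_trans (fdeg (subsetP (levelU i.+1) _ yi)) _.
  apply: leq_trans (leq_card_setU _ _); apply/subset_leq_card/subsetP => z.
  rewrite in_set in_setU => fyz; apply/orP.
  by have [zl|/andP[_ zl]] := level_succ yi fyz; [left|right];
    rewrite in_set; apply/andP.
rewrite layer_sym => b3; move: b1 b2 b3 IH k0 q0.
move: (\sum_(_ in level i.+1) _) (\sum_(_ in level i) _) => s1 s2.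
move: #|level i.+2| #|level i.+1| #|level i|; clear => b a c b1 b2 b3 IH k0 q0.
have ab : c <= a by apply: leq_trans IH; rewrite leq_pmull.
rewrite -(leq_pmul2l (m := 2 * k)) ?muln_gt0 //.
have : 2 * k * c <= 2 * k * a by rewrite leq_mul2l ab orbT.
by lia.
Qed.

Lemma bipartite_even_cycle_free_card i : i <= k -> q ^ i <= #|U|.
Proof.
move=> ik; apply: leq_trans (subset_leq_card (levelU i)).
elim: i ik => [|i IHi] ik; first by rewrite /= cards1.
by rewrite expnS (leq_trans _ (level_growth ik)) // leq_mul2l IHi ?orbT // ltnW.
Qed.
End Rooted.
End BondySimonovits.

(** Take a maximum cut of the graph induced on [U]: moving [v] across would exchange its crossing
    and non-crossing edges. *)
Lemma exists_large_cross_degree (T : finType) (e : rel T) (U : {set T}) :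
  symmetric e -> irreflexive e -> exists X : {set T}, forall v, v \in U ->
  degree_in e U v <=
    (degree_in [rel x y | e x y && ((x \in X) != (y \in X))] U v).*2.
Proof.
move=> esym eirr.
pose c (X : {set T}) := [rel x y | e x y && ((x \in X) != (y \in X))].
pose N X := \sum_(u in U) degree_in (c X) U u.
have [X _ maxX] := arg_maxnP N (erefl : predT set0).
exists X => v vU; pose X' := [set x | (x \in X) (+) (x == v)].
have csym Y : symmetric (c Y) by move=> x y /=; rewrite esym [_ == _ :> bool]eq_sym.
have cirr Y : irreflexive (c Y) by move=> x /=; rewrite eirr.
have := maxX X' isT; rewrite /N !(sum_degree_inD1 (csym _) (cirr _) vU).
have -> : \sum_(u in U :\ v) degree_in (c X') (U :\ v) u =
          \sum_(u in U :\ v) degree_in (c X) (U :\ v) u.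
  apply: eq_bigr => u; rewrite in_setD1 => /andP[uv _]; apply: eq_card => y.
  rewrite !inE /= !inE (negbTE uv).
  by case: (eqVneq y v) => //= yv; rewrite !addbF.
have -> : degree_in e U v = degree_in (c X) U v + degree_in (c X') U v.
  rewrite !degree_in_sum -big_split /=; apply: eq_bigr => y _ /=.
  have [->|yv] := eqVneq y v; first by rewrite eirr.
  by rewrite !inE eqxx (negbTE yv) addbF addbT; case: (e v y); do 2 case: (_ \in X).
by rewrite -/(c X); lia.
Qed.

(** Passing to a bipartite subgraph halves the degrees, which turns the factor 4 into the factor 2
    needed for the level growth. *)
Lemma even_cycle_free_min_degree (T : finType) (e : rel T) (k q : nat) (U : {set T}) :
  symmetric e -> irreflexive e -> ~ contains_cycle e (2 * k) -> 0 < k -> 0 < q ->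
  U != set0 -> (forall v, v \in U -> 4 * k * (q + 3) <= degree_in e U v) ->
  q ^ k <= #|U|.
Proof.
move=> esym eirr C2k k0 q0 /set0Pn[x xU] Udeg.
have [X Xdeg] := exists_large_cross_degree U esym eirr.
pose f := [rel x y | [&& x \in U, y \in U, e x y & (x \in X) != (y \in X)]].
apply: (@bipartite_even_cycle_free_card T e f (mem X) k q U esym _ _ _ _ _ k0 q0 C2k x xU k (leqnn k)).
- by move=> u v /=; rewrite esym eq_sym; do 2 case: (_ \in U).
- by move=> u v /and4P[].
- by move=> u v /and4P[_ _ _]; rewrite !inE; do 2 case: (_ \in X).
- by move=> u v /and4P[].
- move=> v vU; have := Xdeg v vU; have := Udeg v vU.
  suff -> : #|[set y | f v y]| =
    degree_in [rel x y | e x y && ((x \in X) != (y \in X))] U v by lia.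
  by apply: eq_card => y; rewrite !inE /= vU.
Qed.

Local Open Scope ring_scope.

(** * Random sign assignments that split a matching *)

Section Signs.
Variables (R : rcfType) (T : finType).
Implicit Types (V S : {set T}) (x y : T).

Definition sgn V x : R := (-1) ^+ (x \notin V).

Definition flip S V : {set T} := [set x | (x \in V) (+) (x \in S)].

Lemma sgn_flip S V x : sgn (flip S V) x = (-1) ^+ (x \in S) * sgn V x.
Proof.
by rewrite /sgn !inE; case: (x \in V); case: (x \in S); rewrite /= ?expr0 ?expr1; ring.
Qed.

Lemma sgnK V x : sgn V x * sgn V x = 1.
Proof. by rewrite /sgn; case: (_ \notin _); rewrite ?expr0 ?expr1; ring. Qed.

Lemma flipK S : involutive (flip S).
Proof. by move=> V; apply/setP => x; rewrite !inE; do 2 case: (_ \in _). Qed.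

(* The sum is over ordered pairs, so the cut [(V, ~: V)] has [m / 2 + surplus / 4]
   edges. *)
Definition surplus (e : rel T) V : R :=
  - \sum_x \sum_(y | e x y) sgn V x * sgn V y.

Section Paired.
Variable mu : T -> T.
Hypothesis muK : involutive mu.

(** A matching is encoded by an involution whose fixed points are the unmatched vertices. *)
Definition matched : {set T} := [set x | mu x != x].

Lemma mem_matched x : (x \in matched) = (mu x != x).
Proof. by rewrite inE. Qed.

Lemma matched_mu x : (mu x \in matched) = (x \in matched).
Proof. by rewrite !inE muK eq_sym. Qed.

Definition mu_stable (A : {set T}) := forall x, (mu x \in A) = (x \in A).

(* The sample space of the random arguments: the sides of the cuts that separate
   every [x] from its partner [mu x], under the uniform distribution. *)
Definition split_pairs : {set {set T}} :=
  [set V : {set T} | [forall x in matched, (mu x \in V) == (x \notin V)]].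

Lemma split_pairsP V :
  reflect (forall x, x \in matched -> (mu x \in V) = (x \notin V)) (V \in split_pairs).
Proof.
rewrite inE; apply: (iffP forall_inP) => H x xM; first exact/eqP/H.
exact/eqP/H.
Qed.

Lemma sgn_split V x : V \in split_pairs -> x \in matched -> sgn V (mu x) = - sgn V x.
Proof.
move=> /split_pairsP VP xM; rewrite /sgn VP //.
by case: (x \in V); rewrite /= ?expr0 ?expr1 ?opprK.
Qed.

Lemma split_pairs_neq0 : exists V, V \in split_pairs.
Proof.
exists [set x | (enum_rank x < enum_rank (mu x))%N]; apply/split_pairsP => x.
rewrite !inE muK => xM; rewrite -leqNgt [in RHS]leq_eqVlt.
case: eqP => //= /val_inj /enum_rank_inj mux; by rewrite mux eqxx in xM.
Qed.

Lemma setC_split V : V \in split_pairs -> ~: V \in split_pairs.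
Proof. by move=> /split_pairsP VP; apply/split_pairsP => x xM; rewrite !inE VP. Qed.

Lemma flip_split S V : mu_stable S -> (flip S V \in split_pairs) = (V \in split_pairs).
Proof.
move=> stS; apply/split_pairsP/split_pairsP => H x xM; have := H x xM;
  by rewrite !inE stS; do 3 case: (_ \in _).
Qed.

Lemma sum_flip S (F : {set T} -> R) : mu_stable S ->
  \sum_(V in split_pairs) F (flip S V) = \sum_(V in split_pairs) F V.
Proof.
move=> stS; rewrite [RHS](reindex_inj (inv_inj (@flipK S))) /=.
by apply: eq_bigl => V; rewrite flip_split.
Qed.

(** Flipping a [mu]-stable set permutes the sample space. This symmetry replaces independence
    throughout. *)
Lemma sum_flip_odd S (F : {set T} -> R) : mu_stable S ->
  (forall V, V \in split_pairs -> F (flip S V) = - F V) ->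
  \sum_(V in split_pairs) F V = 0.
Proof.
move=> stS FN; have := sum_flip F stS; rewrite (eq_bigr _ FN) sumrN; lra.
Qed.

Definition mu_closure (A : {set T}) := [set x | (x \in A) || (mu x \in A)].

Lemma mu_closure_stable A : mu_stable (mu_closure A).
Proof. by move=> x; rewrite !inE muK orbC. Qed.

Let N : R := #|split_pairs|%:R.

Lemma card_split_gt0 : 0 < N.
Proof.
by rewrite ltr0n; apply/card_gt0P; have [V VP] := split_pairs_neq0; exists V.
Qed.

(** One vertex at most from each pair, so that the signs on [P] are independent. *)
Definition transversal_set (P : {set T}) :=
  forall y, y \in P -> y \in matched -> mu y \notin P.

(** Split off one vertex [y]. Flipping its pair leaves the rest [X'] unchanged, so all terms with an
    odd power of the sign of [y] vanish on average. *)
Lemma moments (P : {set T}) (c : T -> R) : transversal_set P ->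
  let X V := \sum_(y in P) c y * sgn V y in
  let v := \sum_(y in P) c y ^+ 2 in
  \sum_(V in split_pairs) X V ^+ 2 = N * v /\
  \sum_(V in split_pairs) X V ^+ 4 <= N * (3 * v ^+ 2).
Proof.
have [n] := ubnP #|P|; elim: n P => // n IHn P leP trP X v.
have [P0|/set0Pn[y yP]] := eqVneq P set0.
  have X0 V : X V = 0 by rewrite /X P0 big_set0.
  have v0 : v = 0 by rewrite /v P0 big_set0.
  split; first by rewrite v0 mulr0 big1 // => V _; rewrite X0 expr0n.
  rewrite big1 => [|V _]; last by rewrite X0 expr0n.
  by rewrite v0 expr0n /= !mulr0.
have [||IH2 IH4] := IHn (P :\ y).
- by have := cardsD1 y P; rewrite yP; lia.
- move=> z; rewrite !inE => /andP[_ zP] zM; rewrite (negbTE (trP z zP _)) ?andbF //.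
  by rewrite inE.
set X' := fun V => \sum_(z in P :\ y) c z * sgn V z in IH2 IH4.
set v' := \sum_(z in P :\ y) c z ^+ 2 in IH2 IH4.
have XE V : X V = X' V + c y * sgn V y by rewrite /X (big_setD1 y) //= addrC.
have vE : v = v' + c y ^+ 2 by rewrite /v (big_setD1 y) //= addrC.
have odd0 F : (forall S V, mu_stable S -> [disjoint S & P :\ y] -> F (flip S V) = F V) ->
    \sum_(V in split_pairs) F V * sgn V y = 0.
  move=> FS; have st := mu_closure_stable [set y].
  apply: (sum_flip_odd st) => V _; rewrite sgn_flip !inE eqxx FS //.
    by rewrite expr1; ring.
  rewrite disjoint_subset; apply/subsetP => z; rewrite !inE negb_and negbK.
  case: (eqVneq z y) => //= zy /eqP mzy; apply/negP => zP.
  have := trP z zP; rewrite inE mzy eq_sym zy => /(_ isT); by rewrite yP.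
have X'S S V : mu_stable S -> [disjoint S & P :\ y] -> X' (flip S V) = X' V.
  move=> _ dis; apply: eq_bigr => z zP; rewrite sgn_flip.
  by rewrite (disjointFl dis zP) expr0 mul1r.
have e1 := odd0 X' X'S.
have e3 : \sum_(V in split_pairs) X' V ^+ 3 * sgn V y = 0.
  by apply: odd0 => S V st dis; rewrite X'S.
split.
  have E V : X V ^+ 2 = X' V ^+ 2 + 2 * c y * (X' V * sgn V y) + c y ^+ 2.
    by have := sgnK V y; rewrite XE => s2; ring: s2.
  rewrite (eq_bigr _ (fun V _ => E V)) !big_split /= -mulr_sumr e1 IH2 vE.
  by rewrite sumr_const -mulr_natl -/N; ring.
have [d dE] : exists d, d = c y ^+ 4 by eexists.
have E V : X V ^+ 4 = X' V ^+ 4 + 4 * c y * (X' V ^+ 3 * sgn V y) +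
    6 * c y ^+ 2 * X' V ^+ 2 + 4 * c y ^+ 3 * (X' V * sgn V y) + d.
  by have := sgnK V y; rewrite XE dE => s2; ring: s2.
rewrite (eq_bigr _ (fun V _ => E V)) !big_split /= -!mulr_sumr e1 e3 IH2 vE.
rewrite sumr_const -[d *+ _]mulr_natl -/N dE.
have := sqr_ge0 (c y ^+ 2); have := card_split_gt0; move: IH4.
by rewrite -/N; nra.
Qed.

(** With [t] the square root of the variance, the second and fourth moments give a mean of at least
    [t - 3 * t / 4], whence the constant 4. *)
Lemma khintchine (P : {set T}) (c : T -> R) : transversal_set P ->
  N * (Num.sqrt (\sum_(y in P) c y ^+ 2) / 4) <=
  \sum_(V in split_pairs) `|\sum_(y in P) c y * sgn V y|.
Proof.
move=> trP; have [m2 m4] := moments c trP.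
set v := \sum_(y in P) c y ^+ 2 in m2 m4 *; set X := fun V => \sum_(y in P) c y * sgn V y.
have v0 : 0 <= v by apply: sumr_ge0 => y _; apply: sqr_ge0.
have [vz|vnz] := eqVneq v 0.
  by rewrite vz sqrtr0 mul0r mulr0; apply: sumr_ge0.
set t := Num.sqrt v; have tv : t ^+ 2 = v by rewrite sqr_sqrtr.
have t0 : 0 < t by rewrite sqrtr_gt0 lt_neqAle eq_sym vnz.
(* [a^2 - a^4 / 4 <= a], to be averaged with [E X^2 = t^2] and [E X^4 <= 3 t^4] *)
have pt u : 0 <= u -> u ^+ 2 / t - u ^+ 4 / (4 * t ^+ 3) <= u.
  move=> u0; set a := u / t; have a0 : 0 <= a by rewrite divr_ge0 // ltW.
  have -> : u ^+ 2 / t - u ^+ 4 / (4 * t ^+ 3) = t * (a ^+ 2 - a ^+ 4 / 4).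
    by rewrite /a; field; rewrite gt_eqF.
  have {1}-> : u = t * a by rewrite /a; field; rewrite gt_eqF.
  rewrite ler_pM2l // -subr_ge0.
  (* A certificate that [1 - a + a ^+ 3 / 4] is nonnegative: the double root 6/5 lies close to its
     minimiser. *)
  have -> : a - (a ^+ 2 - a ^+ 4 / 4) = a * ((a - 6 / 5) ^+ 2 * (a + 12 / 5) / 4
    + (1 - 216 / 250) + 2 / 25 * a) by field.
  apply: mulr_ge0 => //; have : 0 <= (a - 6 / 5) ^+ 2 * (a + 12 / 5).
    by apply: mulr_ge0; [apply: sqr_ge0 | lra].
  lra.
have : \sum_(V in split_pairs) (X V ^+ 2 / t - X V ^+ 4 / (4 * t ^+ 3)) <=
    \sum_(V in split_pairs) `|X V|.
  apply: ler_sum => V _; apply: le_trans (pt _ (normr_ge0 _)).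
  by rewrite -[4%N]/(2 * 2)%N !exprM !real_normK ?num_real.
apply: le_trans; rewrite sumrB -!mulr_suml m2.
have : (\sum_(V in split_pairs) X V ^+ 4) / (4 * t ^+ 3) <= N * (3 * t / 4).
  rewrite ler_pdivrMr; last by rewrite mulr_gt0 // exprn_gt0.
  by apply: le_trans m4 _; rewrite -tv le_eqVlt; apply/orP; left; apply/eqP; field.
have -> : N * v / t = N * t by rewrite -tv; field; rewrite gt_eqF.
lra.
Qed.

(** The second moment is [#|P|]; the arithmetic-geometric mean inequality passes from squares to
    absolute values. *)
Lemma sum_abs_le_sqrt (P : {set T}) : transversal_set P ->
  \sum_(V in split_pairs) `|\sum_(y in P) sgn V y| <= N * Num.sqrt #|P|%:R.
Proof.
move=> trP; have [m2 _] := moments (fun=> 1) trP; move: m2 => /=.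
have -> : \sum_(y in P) (1 : R) ^+ 2 = #|P|%:R.
  by rewrite expr1n sumr_const.
set t := Num.sqrt #|P|%:R; have tP : t ^+ 2 = #|P|%:R by rewrite sqr_sqrtr ?ler0n.
rewrite -tP => m2.
have X1 V : \sum_(y in P) 1 * sgn V y = \sum_(y in P) sgn V y.
  by apply: eq_bigr => y _; rewrite mul1r.
have [t0|t_neq0] := eqVneq t 0.
  have : #|P| = 0%N by apply/eqP; rewrite -(eqr_nat R) -tP t0 expr0n.
  move=> /cards0_eq ->; rewrite t0 mulr0 big1 // => V _; by rewrite big_set0 normr0.
have t_gt0 : 0 < t by rewrite lt_neqAle eq_sym t_neq0 sqrtr_ge0.
have pt u : `|u| <= (u ^+ 2 / t + t) / 2.
  rewrite -(real_normK (num_real u)) -subr_ge0.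
  have -> : (`|u| ^+ 2 / t + t) / 2 - `|u| = (`|u| - t) ^+ 2 / (2 * t).
    by field; rewrite gt_eqF.
  by apply: divr_ge0; [apply: sqr_ge0 | lra].
apply: (le_trans (ler_sum _ (fun V _ => pt _))).
rewrite -mulr_suml big_split /= -mulr_suml.
rewrite (eq_bigr (fun V => (\sum_(y in P) 1 * sgn V y) ^+ 2)); last first.
  by move=> V _; rewrite X1.
rewrite m2 sumr_const -mulr_natl -/N le_eqVlt; apply/orP; left; apply/eqP.
by field.
Qed.

End Paired.
End Signs.

(** * Local majority *)

Section LocalMajority.
Variables (R : rcfType) (T : finType) (e : rel T) (mu : T -> T).
Hypotheses (esym : symmetric e) (eirr : irreflexive e) (muK : involutive mu).
Hypothesis emu : forall x, x \in matched mu -> e x (mu x).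
Variables (B Lead : {set T}) (N : T -> {set T}).
Hypotheses (Bst : mu_stable mu B) (BM : B \subset matched mu).
Hypothesis LeadP : Lead \in split_pairs mu.

Implicit Types (S V : {set T}) (u v x y : T).

(** Adjacency of the two pairs once every pair is contracted to a point. *)
Definition class_adj x y := [|| e x y, e x (mu y), e (mu x) y | e (mu x) (mu y)].

(** The signs on [B] are recomputed, and [N x] lists the neighbours that [x] consults. The
    conditions say that these lie outside [B] and keep their random signs, that a consulted edge is
    the only one between its two pairs, and that adjacent pairs of [B] consult disjoint sets of
    pairs. *)
Hypothesis Ne : forall x y, x \in B -> y \in N x -> e x y && (y \notin B).
Hypothesis Nmu : forall x y, x \in B -> y \in N x -> y \in matched mu -> ~~ e x (mu y).
Hypothesis Nmux : forall x y, x \in B -> y \in N x -> ~~ e (mu x) y && ~~ e (mu x) (mu y).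
Hypothesis Ndisj : forall x x' y, x \in B -> x' \in B -> x' != x -> x' != mu x ->
  class_adj x x' -> y \in N x -> (y \notin N x') && (mu y \notin N x').

Definition field (V : {set T}) x : R := \sum_(y in N x) sgn R V y.

(** The side opposite to the majority. A tie is broken by the random sign of [x] itself, so flipping
    [x] together with [N x] always flips the choice. *)
Definition majority_side (V : {set T}) x :=
  if field V x == 0 then x \in V else field V x < 0.

Definition local_majority (V : {set T}) : {set T} :=
  [set x | if x \in B then
             if x \in Lead then majority_side V x else ~~ majority_side V (mu x)
           else x \in V].

Let lead x := if x \in Lead then x else mu x.

Let matchedB x : x \in B -> x \in matched mu. Proof. exact/subsetP. Qed.

Let leadB x : (lead x \in B) = (x \in B).
Proof. by rewrite /lead; case: ifP => _ //; apply: Bst. Qed.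

Let mu_lead x : x \in B -> (mu x \in Lead) = (x \notin Lead).
Proof. by move=> xB; have /split_pairsP := LeadP; apply; apply: matchedB. Qed.

Let lead_Lead x : x \in B -> lead x \in Lead.
Proof. by move=> xB; rewrite /lead; case: ifPn => // xL; rewrite mu_lead. Qed.

Lemma local_majority_split V :
  V \in split_pairs mu -> local_majority V \in split_pairs mu.
Proof.
move=> /split_pairsP VP; apply/split_pairsP => x xM; rewrite !inE Bst.
case: ifP => xB; last by apply: VP.
by rewrite mu_lead // muK; case: (x \in Lead); rewrite ?negbK.
Qed.

Lemma local_majority_out V x : x \notin B -> (x \in local_majority V) = (x \in V).
Proof. by move=> xB; rewrite inE (negbTE xB). Qed.

Let fieldE S V x (b : bool) : (forall y, y \in N x -> (y \in S) = b) ->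
  field (flip S V) x = (-1) ^+ b * field V x.
Proof.
move=> NS; rewrite /field mulr_sumr; apply: eq_bigr => y yN.
by rewrite sgn_flip NS.
Qed.

Let sideE S V x (b : bool) : (x \in S) = b ->
  (forall y, y \in N x -> (y \in S) = b) ->
  majority_side (flip S V) x = b (+) majority_side V x.
Proof.
move=> xS NS; rewrite /majority_side (fieldE V NS).
case: b xS {NS} => xS; rewrite ?expr0 ?expr1 ?mul1r ?mulN1r ?oppr_eq0.
  case: eqP => [_|/eqP f0]; first by rewrite inE xS addbT addTb.
  by rewrite oppr_lt0 lt_neqAle eq_sym f0 /= -leNgt.
by case: eqP => // _; rewrite inE xS addbF.
Qed.

Let sgn_sideE S V x (b : bool) : x \in B -> (lead x \in S) = b ->
  (forall y, y \in N (lead x) -> (y \in S) = b) ->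
  sgn R (local_majority (flip S V)) x = (-1) ^+ b * sgn R (local_majority V) x.
Proof.
move=> xB lS NS; rewrite /sgn !inE xB.
have := sideE V lS NS; rewrite /lead; case: ifP => _ ->.
  by case: b {lS NS}; case: majority_side; rewrite /= ?expr0 ?expr1; ring.
by case: b {lS NS}; case: majority_side; rewrite /= ?expr0 ?expr1; ring.
Qed.

Let sgn_outE S V x : x \notin B ->
  sgn R (local_majority (flip S V)) x =
  (-1) ^+ (x \in S) * sgn R (local_majority V) x.
Proof.
by move=> xB; rewrite -sgn_flip /sgn !local_majority_out // !inE (negbTE xB).
Qed.

Let corr u v : R :=
  \sum_(V in split_pairs mu) sgn R (local_majority V) u * sgn R (local_majority V) v.

Let corrC u v : corr u v = corr v u.
Proof. by apply: eq_bigr => V _; rewrite mulrC. Qed.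

(* Every correlation outside the matching and the active edges vanishes because
   some flip reverses the sign of exactly one end. *)
Let corr0 S u v : mu_stable mu S ->
  (forall V, sgn R (local_majority (flip S V)) u = - sgn R (local_majority V) u) ->
  (forall V, sgn R (local_majority (flip S V)) v = sgn R (local_majority V) v) ->
  corr u v = 0.
Proof.
move=> st Hu Hv; apply: (sum_flip_odd (mu := mu) st) => V _.
by rewrite Hu Hv mulNr.
Qed.

Let corr_out u v : u \notin B -> v \notin B -> e u v -> v != mu u -> corr u v = 0.
Proof.
move=> uB vB euv vu; apply: (@corr0 (mu_closure mu [set u])) => [|V|V].
- exact: mu_closure_stable.
- by rewrite sgn_outE // !inE eqxx expr1 mulN1r.
- rewrite sgn_outE // !inE; case: eqP => [vu'|_]; first by rewrite vu' eirr in euv.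
  case: eqP => [mvu|_]; first by rewrite -mvu muK eqxx in vu.
  by rewrite expr0 mul1r.
Qed.

(** Flip the pair of [v]: the leader of [u] consults neither [v] nor [mu v], by the last assumption,
    [Nmu] and [Nmux]. *)
Let corr_mixed u v : u \in B -> v \notin B -> e u v ->
  ~~ ((u \in Lead) && (v \in N u)) -> corr u v = 0.
Proof.
move=> uB vB euv notN; have lB : lead u \in B by rewrite leadB.
have vN : v \notin N (lead u).
  apply/negP => vN; move: notN vN; rewrite /lead; case: ifP => uL /=.
    by move=> /negP.
  move=> _ vN; have := Nmux _ vN; rewrite Bst => /(_ uB) /andP[/negP].
  by rewrite muK.
have mvN : mu v \notin N (lead u).
  apply/negP => mvN; have := Nmux lB mvN; have := Nmu lB mvN.
  rewrite matched_mu // muK mem_matched /lead; case: ifP => uL; last first.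
    by rewrite muK euv andbF.
  case: (eqVneq (mu v) v) => [mv|_ /(_ isT)]; last by rewrite euv.
  by move: mvN notN; rewrite mv /lead uL => ->.
rewrite corrC; apply: (@corr0 (mu_closure mu [set v])) => [|V|V].
- exact: mu_closure_stable.
- by rewrite sgn_outE // !inE eqxx expr1 mulN1r.
- rewrite (@sgn_sideE _ _ _ false) ?expr0 ?mul1r //.
    rewrite !inE; apply/negbTE; rewrite negb_or; apply/andP; split.
      by apply: contra vB => /eqP <-.
    by apply: contra vB => /eqP <-; rewrite Bst.
  move=> y yN; rewrite !inE; apply/negbTE; rewrite negb_or; apply/andP; split.
    by apply: contra vN => /eqP <-.
  by apply: contra mvN => /eqP <-; rewrite muK.
Qed.

(** Flip the leader of [u], all that it consults and their partners. By [Ndisj] this set misses the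
    leader of [v] and all that it consults. *)
Let corr_in u v : u \in B -> v \in B -> e u v -> v != mu u -> corr u v = 0.
Proof.
move=> uB vB euv vmu; set l := lead u; set l' := lead v.
have lB : l \in B by rewrite leadB.
have l'B : l' \in B by rewrite leadB.
have lL := lead_Lead uB; have l'L := lead_Lead vB; rewrite -/l in lL; rewrite -/l' in l'L.
have vu : v != u by apply/eqP => vu; rewrite vu eirr in euv.
have ll' : l' != l.
  rewrite /l /l' /lead; case: ifP => vL; case: ifP => uL //.
    by apply: contra vmu => /eqP <-; rewrite muK.
  by apply: contra vu => /eqP mm; rewrite -(muK v) mm muK.
have l'ml : l' != mu l by apply: contraTneq l'L => ->; rewrite mu_lead // negbK.
have adj : class_adj l l'.
  by rewrite /class_adj /l /l' /lead; case: ifP => _; case: ifP => _; rewrite ?muK euv ?orbT.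
apply: (@corr0 (mu_closure mu (l |: N l))) => [|V|V].
- exact: mu_closure_stable.
- rewrite (@sgn_sideE _ _ _ true) ?expr1 ?mulN1r //; first by rewrite !inE eqxx.
  by move=> y yN; rewrite !inE yN !orbT.
- rewrite (@sgn_sideE _ _ _ false) ?expr0 ?mul1r //.
    rewrite -/l' !inE; apply/negbTE; rewrite !negb_or ll' /=.
    have -> /= : l' \notin N l by apply/negP => /(Ne lB); rewrite l'B andbF.
    have -> /= : mu l' \notin N l by apply/negP => /(Ne lB); rewrite Bst l'B andbF.
    by rewrite andbT; apply: contra l'ml => /eqP <-; rewrite muK.
  move=> y yN; have /andP[ely yB] := Ne l'B yN.
  rewrite !inE; apply/negbTE; rewrite !negb_or; apply/andP; split; apply/andP; split.
  + by apply: contra yB => /eqP ->.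
  + apply/negP => yNl; have := Ndisj lB l'B ll' l'ml adj yNl.
    by rewrite yN.
  + by apply: contra yB => /eqP yl; rewrite -Bst yl.
  + apply/negP => yNl; have := Ndisj lB l'B ll' l'ml adj yNl.
    by rewrite muK yN andbF.
Qed.

Let gainful u v := [&& u \in B, u \in Lead & v \in N u].

Let corrE u v : e u v ->
  corr u v = (if v == mu u then - #|split_pairs mu|%:R else 0)
    + (if gainful u v then corr u v else 0) + (if gainful v u then corr v u else 0).
Proof.
move=> euv; have [vmu|vmu] := eqVneq v (mu u).
  have uM : u \in matched mu.
    by rewrite mem_matched; apply: contraTneq euv; rewrite vmu => ->; rewrite eirr.
  have noB x : x \in B -> mu x \notin N x by move=> xB; apply/negP => /(Ne xB); rewrite Bst xB andbF.
  have -> : gainful u v = false.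
    by rewrite /gainful vmu; case: (boolP (u \in B)) => //= /noB /negbTE ->; rewrite andbF.
  have -> : gainful v u = false.
    rewrite /gainful vmu; case: (boolP (mu u \in B)) => //= /noB; rewrite muK => /negbTE ->.
    by rewrite andbF.
  rewrite !addr0 /corr vmu (eq_bigr (fun=> -1)) => [|V VP].
    by rewrite sumr_const mulNrn.
  by rewrite sgn_split ?local_majority_split // mulrN sgnK.
rewrite add0r; have [uB|uB] := boolP (u \in B); have [vB|vB] := boolP (v \in B).
- have -> : gainful u v = false.
    by rewrite /gainful uB /=; case: (boolP (v \in N u)) => [/(Ne uB)|]; rewrite ?vB ?andbF.
  have -> : gainful v u = false.
    by rewrite /gainful vB /=; case: (boolP (u \in N v)) => [/(Ne vB)|]; rewrite ?uB ?andbF.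
  by rewrite corr_in // addr0.
- have -> : gainful v u = false by rewrite /gainful (negbTE vB).
  rewrite addr0 /gainful uB /=; case: ifPn => // notN; exact: corr_mixed.
- have -> : gainful u v = false by rewrite /gainful (negbTE uB).
  rewrite add0r /gainful vB /=; case: ifPn => notN; first by rewrite corrC.
  by rewrite corrC; apply: corr_mixed => //; rewrite esym.
- have -> : gainful u v = false by rewrite /gainful (negbTE uB).
  have -> : gainful v u = false by rewrite /gainful (negbTE vB).
  by rewrite addr0 corr_out.
Qed.

Let gain u : u \in B -> u \in Lead -> \sum_(v in N u) corr u v =
  - \sum_(V in split_pairs mu) `|field V u|.
Proof.
move=> uB uL; rewrite /corr exchange_big -sumrN; apply: eq_bigr => V _.
rewrite -mulr_sumr.
have -> : \sum_(v in N u) sgn R (local_majority V) v = field V u.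
  apply: eq_bigr => v vN; have /andP[_ vB] := Ne uB vN.
  by rewrite /sgn local_majority_out.
rewrite {1}/sgn inE uB uL /majority_side; have [->|f0] := eqVneq (field V u) 0.
  by rewrite mulr0 normr0 oppr0.
have [fneg|fpos] := ltrP (field V u) 0; rewrite /= ?expr0 ?expr1.
  by rewrite mul1r ltr0_norm // opprK.
by rewrite mulN1r ger0_norm.
Qed.

(** A matching edge contributes one for each end. A leader in [B] opposes the field of the set it
    consults, which yields the absolute field in both orientations. All other correlations
    vanish. *)
Lemma sum_surplus_local_majority :
  \sum_(V in split_pairs mu) surplus R e (local_majority V) =
  #|split_pairs mu|%:R * #|matched mu|%:R
  + 2 * \sum_(u in B :&: Lead) \sum_(V in split_pairs mu) `|field V u|.
Proof.
have gainS : \sum_u \sum_(v | e u v) (if gainful u v then corr u v else 0) =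
    - \sum_(u in B :&: Lead) \sum_(V in split_pairs mu) `|field V u|.
  rewrite -sumrN [RHS]big_mkcond /=; apply: eq_bigr => u _; rewrite in_setI /gainful.
  case: (boolP (u \in B)) => uB /=; last by rewrite big1.
  case: (boolP (u \in Lead)) => uL /=; last by rewrite big1.
  rewrite -gain // big_mkcond [RHS]big_mkcond; apply: eq_bigr => v _ /=.
  by case: (boolP (v \in N u)) => [/(Ne uB)/andP[->]|_]; case: (e u v).
have muS : \sum_u \sum_(v | e u v) (if v == mu u then - #|split_pairs mu|%:R else 0) =
    - (#|split_pairs mu|%:R * #|matched mu|%:R) :> R.
  move: (#|split_pairs mu|%:R : R) => c.
  rewrite -mulNr mulr_natr -sumr_const [RHS]big_mkcond /=; apply: eq_bigr => u _.
  rewrite -big_mkcondr; case: ifPn => [uM|]; last first.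
    rewrite mem_matched negbK => /eqP muu; apply: big_pred0 => v.
    by rewrite muu; case: eqP => [->|]; rewrite ?eirr ?andbF.
  rewrite (big_pred1 (mu u)) // => v.
  by rewrite /= andbC; case: eqP => //= ->; apply: emu.
have -> : \sum_(V in split_pairs mu) surplus R e (local_majority V) =
    - \sum_u \sum_(v | e u v) corr u v.
  rewrite sumrN exchange_big; congr (- _); apply: eq_bigr => u _.
  by rewrite exchange_big.
rewrite (eq_bigr _ (fun u _ => eq_bigr _ (fun v => @corrE u v))).
rewrite (eq_bigr _ (fun u _ => big_split _ _ _ _ _)) /= big_split /=.
rewrite (eq_bigr _ (fun u _ => big_split _ _ _ _ _)) /= big_split /=.
rewrite muS gainS.
have -> : \sum_u \sum_(v | e u v) (if gainful v u then corr v u else 0) =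
          \sum_u \sum_(v | e u v) (if gainful u v then corr u v else 0).
  rewrite (exchange_big_dep predT) //=; apply: eq_bigr => u _.
  by apply: eq_bigl => v; rewrite esym.
rewrite gainS; ring.
Qed.

End LocalMajority.

(** * Conflicts in graphs without 4-cycles and 6-cycles *)

Lemma exists_ge_mean (R : realDomainType) (I : finType) (A : {set I}) (F : I -> R) c :
  (0 < #|A|)%N -> #|A|%:R * c <= \sum_(i in A) F i -> exists2 i, i \in A & c <= F i.
Proof.
move=> A0 meanF; apply/exists_inP; apply: contraTT meanF; rewrite negb_exists_in.
move=> /forall_inP small; rewrite -ltNge mulr_natl -sumr_const.
apply: ltr_sum => [|i iA]; last by rewrite ltNge small.
by move/card_gt0P: A0 => [i iA]; apply/hasP; exists i; rewrite ?mem_index_enum.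
Qed.

(** A set [b] is determined by its modification [a |: (b :\: A)], which lies in the event, together
    with its trace on [a |: A]. *)
Lemma card_cylinder (T : finType) (a : T) (A : {set T}) : a \notin A ->
  (2 ^ #|T| <= 2 ^ #|A|.+1 * #|[set b : {set T} | (a \in b) && [disjoint b & A]]|)%N.
Proof.
move=> aA.
pose E := [set b : {set T} | (a \in b) && [disjoint b & A]].
pose f (b : {set T}) := (a |: (b :\: A), b :&: (a |: A)).
have finj : injective f.
  move=> b b' /pair_equal_spec[/setP e1 /setP e2]; apply/setP => x.
  have := e1 x; have := e2 x; rewrite !inE.
  by case: (x == a); case: (x \in A); case: (x \in b); case: (x \in b').
have <- : #|[set: {set T}]| = (2 ^ #|T|)%N.
  by rewrite -powersetT card_powerset cardsT.
rewrite -[X in (X <= _)%N](card_imset _ finj) mulnC.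
have -> : (#|A|.+1 = #|a |: A|)%N by rewrite cardsU1 aA.
rewrite -card_powerset -cardsX.
apply/subset_leq_card/subsetP => _ /imsetP[b _ ->]; rewrite !inE eqxx /= subsetIr andbT.
rewrite disjoint_subset; apply/subsetP => x; rewrite !inE => /orP[/eqP ->//|].
by case/andP.
Qed.

Section ShortCycleFree.
Variables (T : finType) (e : rel T).
Hypotheses (esym : symmetric e) (eirr : irreflexive e).
Hypothesis C4 : ~ contains_cycle e 4.

Let eneq x y : e x y -> x != y.
Proof. by apply: contraTneq => ->; rewrite eirr. Qed.

Lemma common_neighbour_unique x y z z' :
  e x z -> e y z -> e x z' -> e y z' -> x != y -> z = z'.
Proof.
move=> xz yz xz' yz' xy; apply/eqP; apply: contraT => zz'; case: C4.
exists [:: x; z; y; z']; split => //.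
rewrite /ucycle /= !inE !negb_or xz (esym z y) yz yz' (esym z' x) xz' /=.
by rewrite (eneq xz) xy (eneq xz') (eneq yz') zz' /= eq_sym (eneq yz).
Qed.

Lemma card_common_neighbours x y : x != y -> (#|[set z | e x z & e y z]| <= 1)%N.
Proof.
move=> xy; apply/card_le1_eqP => z z'; rewrite !inE => /andP[xz yz] /andP[xz' yz'].
exact: (common_neighbour_unique xz' yz' xz yz xy).
Qed.

Hypothesis C6 : ~ contains_cycle e 6.

Lemma hexagon_free a b c d f g : e a b -> e b c -> e c d -> e d f -> e f g -> e g a ->
  ~~ uniq [:: a; b; c; d; f; g].
Proof.
move=> ab bc cd df fg ga; apply/negP => u; case: C6.
by exists [:: a; b; c; d; f; g]; split => //; rewrite /ucycle u /= ab bc cd df fg ga.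
Qed.

Variable mu : T -> T.
Hypothesis muK : involutive mu.
Hypothesis emu : forall x, x \in matched mu -> e x (mu x).

(* A triangle of matched pairs lifts to a closed walk of length 3 to 6 in the
   graph; lengths 4 and 6 are excluded, and each way to realise length 3 or 5
   occurs for at most one third pair. *)
Lemma card_conflicts x y : x \in matched mu -> e x y -> y != mu x ->
  exists2 Z : {set T}, (#|Z| <= 4)%N &
  forall z, z \in matched mu -> z != x -> z != mu x -> z != y -> z != mu y ->
    class_adj e mu x z -> class_adj e mu z y -> z \in mu_closure mu Z.
Proof.
move=> xM exy ymx; have exmx := emu xM.
have xmx : mu x != x by rewrite -mem_matched.
have mxy : mu x != y by rewrite eq_sym.
have xy := eneq exy.
pose other z := [&& z \in matched mu, z != x, z != mu x, z != y & z != mu y].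
have otherE z : other z -> [/\ other (mu z), e z (mu z), mu z != z & e (mu z) z].
  move=> /and5P[zM zx zmx zy zmy]; rewrite (esym (mu z)) (emu zM) -mem_matched zM; split => //.
  rewrite /other matched_mu // zM (inv_eq muK) zmx (can_eq muK) zx.
  by rewrite (inv_eq muK) zmy (can_eq muK) zy.
(* two distinct such [z] would close up to a hexagon *)
have five a b : a != b ->
    (forall z, other z -> (z != a) && (z != b)) ->
    (#|[set z | [&& other z, e a z & e (mu z) b]]| <= 1)%N.
  move=> ab oab; apply/card_le1_eqP => z z'; rewrite !inE.
  move=> /and3P[oz az zb] /and3P[oz' az' z'b]; apply/eqP; apply: contraT; rewrite eq_sym => zz'.
  have [omz ezmz mzz _] := otherE z oz; have [omz' ez'mz' mzz' emz'z'] := otherE z' oz'.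
  have zmz' : z != mu z'.
    apply/eqP => zmz'; have mz : mu z = z' by rewrite zmz' muK.
    rewrite -zmz' in z'b; rewrite mz in zb.
    by have := common_neighbour_unique az (etrans (esym _ _) z'b) az' (etrans (esym _ _) zb) ab;
      move/eqP; rewrite (negbTE zz').
  have mzmz' : mu z != mu z' by rewrite (can_eq muK).
  have mzz'' : mu z != z' by rewrite (inv_eq muK).
  have := hexagon_free az ezmz zb (etrans (esym _ _) z'b) emz'z' (etrans (esym _ _) az').
  have /andP[za zb'] := oab _ oz; have /andP[mza mzb] := oab _ omz.
  have /andP[z'a z'b'] := oab _ oz'; have /andP[mz'a mz'b] := oab _ omz'.
  rewrite /= !inE !negb_or ab zb' zmz' zz' mzb mzmz' mzz'' mzz'.
  by rewrite ![a == _]eq_sym ![b == _]eq_sym za mza mz'a z'a mz'b z'b' (eq_sym z) mzz.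
have oxy z : other z -> [/\ z != x, z != mu x, z != y & z != mu y].
  by move=> /and5P[].
(* The four sets belong to the closed walks [x z y]; [x (mu x) z (mu y) y]; [x (mu x) z (mu z) y];
   [x z (mu z) (mu y) y]. The first two sets have at most one element by [C4], the other two by
   [five]. *)
pose Z1 := [set z | e x z & e y z].
pose Z2 := [set z | e (mu x) z & e (mu y) z].
pose Z3 := [set z | [&& other z, e (mu x) z & e (mu z) y]].
pose Z4 := [set z | [&& y \in matched mu, other z, e x z & e (mu z) (mu y)]].
have mxmy : mu x != mu y by rewrite (can_eq muK).
exists (Z1 :|: Z2 :|: Z3 :|: Z4).
  have c1 : (#|Z1| <= 1)%N by apply: card_common_neighbours.
  have c2 : (#|Z2| <= 1)%N by apply: card_common_neighbours.
  have c3 : (#|Z3| <= 1)%N by apply: five => // z /oxy[zx zmx zy zmy]; apply/andP.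
  have c4 : (#|Z4| <= 1)%N.
    have [yM|yM] := boolP (y \in matched mu); last first.
      by rewrite /Z4 (negbTE yM) /= (_ : [set z | false] = set0) ?cards0 //; apply/setP => z; rewrite !inE.
    have xmy : x != mu y by rewrite -(inv_eq muK).
    rewrite /Z4 yM /=.
    by apply: five => // z /oxy[zx zmx zy zmy]; apply/andP.
  have := (leq_card_setU (Z1 :|: Z2 :|: Z3) Z4).1.
  have := (leq_card_setU (Z1 :|: Z2) Z3).1; have := (leq_card_setU Z1 Z2).1.
  by move: c1 c2 c3 c4; clear; lia.
have unm : y \notin matched mu -> mu y = y by rewrite mem_matched negbK => /eqP.
have main z : other z -> e x z || e (mu x) z -> class_adj e mu z y ->
    z \in Z1 :|: Z2 :|: Z3 :|: Z4.
  move=> oz; have [_ ezmz mzz emzz] := otherE z oz.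
  have [zx zmx zy zmy] := oxy z oz; have [omz _ _ _] := otherE z oz.
  have [mzx mzmx mzy mzmy] := oxy _ omz.
  have zyN : e (mu x) z -> e z y -> False.
    move=> mxz ezy; case/negP: ymx; apply/eqP.
    by apply: (common_neighbour_unique ezy exy _ exmx zx); rewrite esym.
  have mzyN : e x z -> e (mu z) y -> False.
    move=> xz mzy'; case/negP: zy; apply/eqP.
    by apply: (common_neighbour_unique xz emzz exy mzy'); rewrite eq_sym.
  rewrite !in_setU !in_set -mem_matched oz (esym y z) (esym (mu y) z) /=.
  have [yM|/unm my] := boolP (y \in matched mu); last first.
    rewrite /class_adj my => /orP[xz|xz] /or4P[] h; rewrite ?xz ?h ?orbT //.
    - by case: (mzyN xz h).
    - by case: (mzyN xz h).
  have eymy := emu yM; have xmy : x != mu y by rewrite -(inv_eq muK).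
  move=> /orP[xz|xz] /or4P[] h; rewrite ?xz ?h ?orbT //.
  - case/negP: zy; apply/eqP.
    by apply: (common_neighbour_unique xz _ exy _ xmy); rewrite esym.
  - by case: (mzyN xz h).
  - by case: (zyN xz h).
  - have := hexagon_free exmx xz ezmz h (etrans (esym _ _) eymy) (etrans (esym _ _) exy).
    rewrite /= !inE !negb_or ![x == _]eq_sym xmx zx mzx (eq_sym (mu y)) xmy (eq_sym y) xy.
    rewrite ![mu x == _]eq_sym zmx mzmx (eq_sym (mu y)) mxmy ymx (eq_sym z) mzz zmy zy.
    by rewrite mzmy mzy -mem_matched yM.
move=> z zM zx zmx zy zmy.
have oz : other z by apply/and5P.
have [omz _ _ _] := otherE z oz.
have zC := mu_closure_stable muK (Z1 :|: Z2 :|: Z3 :|: Z4).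
have inC w : w \in Z1 :|: Z2 :|: Z3 :|: Z4 -> w \in mu_closure mu (Z1 :|: Z2 :|: Z3 :|: Z4).
  by move=> wZ; rewrite /mu_closure in_set wZ.
move=> xz zy'.
have mzy' : class_adj e mu (mu z) y.
  by move: zy'; rewrite /class_adj muK; do 4 case: (e _ _).
(* If no edge from the pair of [x] ends at [z], one ends at [mu z], and the roles of [z] and [mu z]
   are exchanged. *)
have [h|h] := boolP (e x z || e (mu x) z); first by apply: inC; apply: main.
rewrite -zC; apply: inC; apply: main => //.
by move: xz h; rewrite /class_adj; do 4 case: (e _ _).
Qed.

End ShortCycleFree.

(** * Local majority with conflicting neighbours deleted *)

Section Shearer.
Variables (R : rcfType) (T : finType) (e : rel T) (mu : T -> T).
Hypotheses (esym : symmetric e) (eirr : irreflexive e) (muK : involutive mu).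
Hypothesis emu : forall x, x \in matched mu -> e x (mu x).
Hypotheses (C4 : ~ contains_cycle e 4) (C6 : ~ contains_cycle e 6).

(* For [y \in good x] the edge [x y] is the only one between the two pairs. *)
Definition good x := [set y | [&& e x y, y != mu x, ~~ e (mu x) y &
  (y \in matched mu) ==> ~~ e x (mu y)]].

(** Deleting every [y] that is adjacent to another pair in [B] which is itself adjacent to the pair
    of [x] is what makes adjacent pairs of [B] consult disjoint sets. *)
Definition active (B : {set T}) x := [set y in good x | (y \notin B) &&
  [forall z in B, ~~ [&& z != x, z != mu x, class_adj e mu x z & class_adj e mu z y]]].

(** The penalty for the imbalance of the unmatched vertices is averaged together with the surplus,
    so one [V] controls both. The factor 1/2 is the doubled gain times the 1/4 of [khintchine]. *)
Lemma exists_surplus_active (B Lead : {set T}) (lam : R) :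
  mu_stable mu B -> B \subset matched mu -> Lead \in split_pairs mu -> 0 <= lam ->
  exists2 V, V \in split_pairs mu &
    #|matched mu|%:R + 2^-1 * \sum_(x in B :&: Lead) Num.sqrt #|active B x|%:R
      - lam * Num.sqrt #|~: matched mu|%:R
    <= surplus R e V - lam * `|\sum_(w in ~: matched mu) sgn R V w|.
Proof.
move=> Bst BM LeadP lam0.
have [||V VP leV] := @exists_ge_mean R _ (split_pairs mu)
  (fun V => surplus R e (local_majority R mu B Lead (active B) V)
    - lam * `|\sum_(w in ~: matched mu) sgn R (local_majority R mu B Lead (active B) V) w|)
  (#|matched mu|%:R + 2^-1 * \sum_(x in B :&: Lead) Num.sqrt #|active B x|%:R
      - lam * Num.sqrt #|~: matched mu|%:R).
- by have [V VP] := split_pairs_neq0 muK; apply/card_gt0P; exists V.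
- have activeP x y : y \in active B x -> [/\ y \in good x, y \notin B &
      forall z, z \in B -> z != x -> z != mu x -> class_adj e mu x z -> ~~ class_adj e mu z y].
    rewrite in_set => /and3P[yg yB /forall_inP H]; split => // z zB zx zmx xz.
    by have := H z zB; rewrite zx zmx xz.
  have goodP x y : y \in good x -> [/\ e x y, y != mu x, ~~ e (mu x) y &
      y \in matched mu -> ~~ e x (mu y)].
    by rewrite in_set => /and4P[? ? ? /implyP].
  have tr x : transversal_set mu (active B x).
    move=> y /activeP[/goodP[_ _ _ H] _ _] /H; apply: contra.
    by case/activeP => /goodP[].
  rewrite sumrB (@sum_surplus_local_majority R T e mu esym eirr muK emu B Lead (active B)) //; first last.
  + move=> x x' y xB x'B x'x x'mx adj /activeP[_ _ /(_ x' x'B x'x x'mx adj)].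
    rewrite /class_adj !negb_or => /and4P[n1 n2 n3 n4]; apply/andP; split.
      by apply: contra n1 => /activeP[/goodP[]].
    by apply: contra n2 => /activeP[/goodP[]].
  (* An edge between [mu x] and [mu y] would close the 4-cycle [x y (mu y) (mu x)]. *)
  + move=> x y xB /activeP[/goodP[exy ymx nmxy _] yB _]; rewrite nmxy /=.
    have xM := subsetP BM _ xB.
    have [yM|] := boolP (y \in matched mu); last first.
      by rewrite mem_matched negbK => /eqP ->.
    apply/negP => mm; case/negP: (ymx); apply/eqP.
    apply: (common_neighbour_unique esym eirr C4 exy _ (emu xM) _ (y := mu y)).
    * by rewrite esym emu.
    * by rewrite esym.
    * by rewrite -(inv_eq muK) eq_sym.
  + by move=> x y xB /activeP[/goodP[]].
  + by move=> x y xB /activeP[/goodP[-> _ _ _] ->].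
  rewrite -mulr_sumr mulrBr mulrDr.
  have WE V : \sum_(w in ~: matched mu) sgn R (local_majority R mu B Lead (active B) V) w =
      \sum_(w in ~: matched mu) sgn R V w.
    apply: eq_bigr => w; rewrite in_setC => wM; rewrite /sgn local_majority_out //.
    by apply: contra wM; apply/subsetP.
  apply: lerB.
    rewrite lerD2l.
    have -> : #|split_pairs mu|%:R * (2^-1 * \sum_(x in B :&: Lead) Num.sqrt #|active B x|%:R)
      = 2 * \sum_(x in B :&: Lead) (#|split_pairs mu|%:R * (Num.sqrt #|active B x|%:R / 4)) :> R.
      by rewrite -mulr_sumr -mulr_suml; field.
    rewrite ler_wpM2l //; apply: ler_sum => x _.
    have := khintchine muK (fun=> 1 : R) (tr x).
    rewrite expr1n sumr_const => kh; apply: (le_trans kh).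
    by apply: ler_sum => V _; rewrite /field; under eq_bigr do rewrite mul1r.
  rewrite mulrCA; apply: ler_wpM2l => //.
  under eq_bigr do rewrite WE.
  apply: sum_abs_le_sqrt => // y; by rewrite in_setC => /negbTE ->.
exists (local_majority R mu B Lead (active B) V) => //.
exact: local_majority_split.
Qed.

(* Average over random [B]: a given good [y] is active at a given [x] as soon as
   one pair falls in [B] and at most five other pairs fall outside. *)
Lemma exists_active_sum (Lead : {set T}) :
  exists B : {set T}, [/\ mu_stable mu B, B \subset matched mu &
    64^-1 * \sum_(x in matched mu :&: Lead) Num.sqrt (#|good x|%:R : R)
    <= \sum_(x in B :&: Lead) Num.sqrt #|active B x|%:R].
Proof.
have [Rep /split_pairsP RepP] := split_pairs_neq0 muK.
(* A uniform set [b] of vertices, read only at one representative of each pair, selects the pairs of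
   [B] independently. *)
pose rep x := if x \in Rep then x else mu x.
have rep_mu x : rep (mu x) = rep x.
  have [xM|] := boolP (x \in matched mu); last by rewrite mem_matched negbK => /eqP ->.
  by rewrite /rep RepP // muK; case: (x \in Rep).
have rep_eq x y : rep x = rep y -> x = y \/ x = mu y.
  rewrite /rep; case: ifP => _; case: ifP => _; [by left|by right| |].
    by move=> <-; right; rewrite muK.
  by move/(can_inj muK); left.
pose Bof (b : {set T}) := [set x in matched mu | rep x \in b].
have Bst b : mu_stable mu (Bof b).
  by move=> x; rewrite ![_ \in Bof b]in_set rep_mu matched_mu.
have BM b : Bof b \subset matched mu.
  by apply/subsetP => x; rewrite in_set => /andP[].
suff [b _ leb] : exists2 b, b \in [set: {set T}] &
    64^-1 * \sum_(x in matched mu :&: Lead) Num.sqrt (#|good x|%:R : R)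
    <= \sum_(x in Bof b :&: Lead) Num.sqrt #|active (Bof b) x|%:R.
  by exists (Bof b).
apply: exists_ge_mean; first by apply/card_gt0P; exists set0; rewrite inE.
have -> : #|[set: {set T}]| = (2 ^ #|T|)%N by rewrite -powersetT card_powerset cardsT.
have hit x y : x \in matched mu -> y \in good x ->
    (2 ^ #|T| <= 64 * #|[set b | (x \in Bof b) && (y \in active (Bof b) x)]|)%N.
  move=> xM yg; have := yg; rewrite in_set => /and4P[exy ymx _ _].
  have xy : y != x by apply: contraTneq exy => ->; rewrite eirr.
  have [Z Z4 Zconf] := card_conflicts esym eirr C4 C6 muK emu xM exy ymx.
  (* The pairs that have to stay out of [B]: that of [y] and at most four conflicting ones. With the
     pair of [x] in [B] this fixes at most six bits, whence 64. *)
  pose A := rep @: (y |: [set z in Z | rep z != rep x]).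
  have repxA : rep x \notin A.
    apply/negP => /imsetP[z]; rewrite !inE => /orP[/eqP ->|/andP[_ rzx]].
      by case/rep_eq => [xy'|xmy]; [rewrite xy' eqxx in xy | rewrite xmy muK eqxx in ymx].
    by move=> rxz; rewrite rxz eqxx in rzx.
  have cardA : (#|A| <= 5)%N.
    apply: leq_trans (leq_imset_card _ _) _; rewrite cardsU1.
    have : (#|[set z in Z | rep z != rep x]| <= #|Z|)%N.
      by apply/subset_leq_card/subsetP => z; rewrite in_set => /andP[].
    by move: Z4; case: (_ \notin _); clear; lia.
  apply: leq_trans (card_cylinder repxA) _.
  have pow : (2 ^ #|A|.+1 <= 2 ^ 6)%N by apply: leq_pexp2l.
  apply: leq_mul => //; apply/subset_leq_card/subsetP => b.
  rewrite in_set => /andP[xb dis]; rewrite in_set; apply/andP; split.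
    by rewrite in_set xM.
  have notb z : z \in A -> z \notin b by move=> zA; rewrite (disjointFl dis zA).
  have yb : rep y \notin b by apply: notb; apply: imset_f; rewrite !inE eqxx.
  rewrite in_set; apply/and3P; split=> //; first by rewrite in_set (negbTE yb) andbF.
  apply/forall_inP => z; rewrite in_set => /andP[zM zb]; apply/negP => /and4P[zx zmx xz zy].
  have zNy : z != y by apply: contraTneq zb => ->.
  have zNmy : z != mu y by apply: contraTneq zb => ->; rewrite rep_mu.
  have rzx : rep z != rep x.
    by apply/eqP => /rep_eq[zx'|zmx']; [rewrite zx' eqxx in zx | rewrite zmx' eqxx in zmx].
  have := Zconf z zM zx zmx zNy zNmy xz zy; rewrite in_set => /orP[zZ|mzZ].
    by have := notb (rep z); rewrite zb => /(_ _)/negP; apply=> //; apply: imset_f; rewrite !inE zZ rzx orbT.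
  have := notb (rep z); rewrite zb => /(_ _)/negP; apply=> //; rewrite -rep_mu.
  by apply: imset_f; rewrite !inE mzZ rep_mu rzx orbT.
have -> : \sum_(b in [set: {set T}]) \sum_(x in Bof b :&: Lead) Num.sqrt #|active (Bof b) x|%:R =
    \sum_(x in matched mu :&: Lead) \sum_(b | x \in Bof b) Num.sqrt (#|active (Bof b) x|%:R : R).
  rewrite (exchange_big_dep (mem (matched mu :&: Lead))) /=; last first.
    by move=> b x _; rewrite !in_setI => /andP[/(subsetP (BM b)) -> ->].
  apply: eq_bigr => x; rewrite in_setI => /andP[_ xL]; apply: eq_bigl => b.
  by rewrite in_setT in_setI xL andbT.
rewrite !mulr_sumr; apply: ler_sum => x; rewrite in_setI => /andP[xM _].
set r := #|good x|; set t := Num.sqrt (r%:R : R).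
have tr : t ^+ 2 = r%:R by rewrite sqr_sqrtr.
have t0 : 0 <= t by apply: sqrtr_ge0.
have [tz|tnz] := eqVneq t 0.
  by rewrite tz !mulr0; apply: sumr_ge0 => b _; apply: sqrtr_ge0.
have tp : 0 < t by rewrite lt_neqAle eq_sym tnz.
(* The count is at most [t ^+ 2], so its square root is at least the count over [t]; only the
   expected count is then needed. *)
have pt (b : {set T}) : #|active (Bof b) x|%:R / t <= Num.sqrt (#|active (Bof b) x|%:R : R).
  set a := #|active (Bof b) x|; rewrite ler_pdivrMr //.
  have {1}<- : Num.sqrt (a%:R : R) ^+ 2 = a%:R by rewrite sqr_sqrtr.
  rewrite expr2 ler_wpM2l ?sqrtr_ge0 // ler_sqrt ?ler0n // ler_nat.
  by apply/subset_leq_card/subsetP => y; rewrite in_set => /andP[].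
apply: le_trans (ler_sum _ (fun b _ => pt b)); rewrite -mulr_suml ler_pdivlMr //.
have dc : (\sum_(b | x \in Bof b) #|active (Bof b) x| =
    \sum_(y in good x) #|[set b | (x \in Bof b) && (y \in active (Bof b) x)]|)%N.
  under eq_bigr do rewrite -sum1_card.
  rewrite (exchange_big_dep (mem (good x))) /=; last first.
    by move=> b y _; rewrite in_set => /andP[].
  by apply: eq_bigr => y _; rewrite -sum1_card; apply: eq_bigl => b; rewrite in_set.
rewrite -natr_sum dc -!mulrA -expr2 tr mulrCA.
have : (2 ^ #|T| * r <= 64 * \sum_(y in good x) #|[set b | (x \in Bof b) && (y \in active (Bof b) x)]|)%N.
  rewrite mulnC /r -sum_nat_const big_distrr /=; apply: leq_sum => y yg; exact: hit.
rewrite -(ler_nat R) !natrM; move: (_%:R * r%:R : R) => p; lra.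
Qed.

Lemma sqrt_add_nat (a b : nat) : Num.sqrt ((a + b)%:R : R) <= Num.sqrt a%:R + b%:R.
Proof.
have bb : (b%:R : R) <= b%:R ^+ 2 by rewrite -natrX ler_nat; clear; case: b => // b; rewrite expnS expn1 leq_pmulr.
have a0 := sqrtr_ge0 (a%:R : R); have b0 : 0 <= (b%:R : R) by [].
rewrite -(ler_pXn2r (n := 2)) ?nnegrE ?sqrtr_ge0 ?addr_ge0 //.
rewrite sqr_sqrtr // natrD sqrrD sqr_sqrtr //.
have : 0 <= Num.sqrt (a%:R : R) * b%:R by apply: mulr_ge0.
lra.
Qed.

(** A neighbour of [x] that is not good is [mu x], the common neighbour of [x] and [mu x], or has
    its partner adjacent to [x]. The last kind is counted from [y]: without 4-cycles [y] and [mu y]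
    have at most one common neighbour. *)
Lemma sum_sqrt_degree_good :
  \sum_(x in matched mu) Num.sqrt (degree e x)%:R <=
  \sum_(x in matched mu) Num.sqrt (#|good x|%:R : R) + 3 * #|matched mu|%:R.
Proof.
pose t x := #|[set y in matched mu | [&& e x y, e x (mu y) & y != mu x]]|.
have dle x : x \in matched mu -> (degree e x <= #|good x| + (2 + t x))%N.
  move=> xM; pose A := mu x |: [set z | e x z & e (mu x) z].
  have -> : degree e x = #|[set y | e x y]| by apply: eq_card => y; rewrite !inE.
  have cA : (#|A| <= 2)%N.
    rewrite cardsU1; have : (#|[set z | e x z & e (mu x) z]| <= 1)%N.
      by apply: card_common_neighbours => //; rewrite eq_sym -mem_matched.
    by case: (_ \notin _); clear; lia.
  apply: (@leq_trans (#|good x| + (#|A| + t x))); last by rewrite leq_add2l leq_add2r.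
  apply: leq_trans (leq_add (leqnn _) (leq_card_setU _ _).1).
  apply: leq_trans (leq_card_setU _ _).1.
  apply/subset_leq_card/subsetP => y; rewrite !in_setU !in_set => exy; rewrite exy in_set1 /=.
  by case: (y == mu x); case: (e (mu x) y); case: (mu y != y); case: (e x (mu y)).
have tsum : (\sum_(x in matched mu) t x <= #|matched mu|)%N.
  rewrite /t; under eq_bigr do rewrite -sum1_card.
  rewrite (exchange_big_dep (mem (matched mu))) /=; last first.
    by move=> x y _; rewrite in_set => /andP[].
  rewrite -[X in (_ <= X)%N]sum1_card; apply: leq_sum => y yM; rewrite sum1_card.
  apply: leq_trans (card_common_neighbours esym eirr C4 (x := y) (y := mu y) _); last first.
    by rewrite eq_sym -mem_matched.
  apply/subset_leq_card/subsetP => x; rewrite -topredE /= => /andP[_]; rewrite !inE => /and4P[_ exy exmy _].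
  by rewrite esym exy esym.
have : \sum_(x in matched mu) Num.sqrt (degree e x)%:R <=
    \sum_(x in matched mu) (Num.sqrt (#|good x|%:R : R) + (2 + t x)%:R).
  apply: ler_sum => x xM; apply: le_trans (sqrt_add_nat _ _).
  by rewrite ler_sqrt ?ler0n // ler_nat dle.
move/le_trans; apply; rewrite big_split /= lerD2l -natr_sum -natrM ler_nat big_split /=.
by rewrite sum_nat_const; move: tsum; clear; lia.
Qed.

(** Choosing between [Lead] and its complement costs a factor 2, so the constant is 1/2 times 1/64
    times 1/2. Half of [#|matched mu|] is given up to cover the vertices that are not good. *)
Lemma exists_surplus_sqrt (lam : R) : 0 <= lam ->
  exists2 V, V \in split_pairs mu &
    #|matched mu|%:R / 2 + 256^-1 * \sum_(x in matched mu) Num.sqrt (degree e x)%:R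
      - lam * Num.sqrt #|~: matched mu|%:R
    <= surplus R e V - lam * `|\sum_(w in ~: matched mu) sgn R V w|.
Proof.
move=> lam0; have [Lead LeadP] := split_pairs_neq0 muK.
have {Lead LeadP}[Lead LeadP half] : exists2 Lead, Lead \in split_pairs mu &
    2^-1 * \sum_(x in matched mu) Num.sqrt (#|good x|%:R : R) <=
    \sum_(x in matched mu :&: Lead) Num.sqrt (#|good x|%:R : R).
  have sumE : \sum_(x in matched mu) Num.sqrt (#|good x|%:R : R) =
      \sum_(x in matched mu :&: Lead) Num.sqrt #|good x|%:R +
      \sum_(x in matched mu :&: ~: Lead) Num.sqrt #|good x|%:R.
    by rewrite (big_setID Lead) /= setDE.
  have [le|lt] := lerP (2^-1 * \sum_(x in matched mu) Num.sqrt (#|good x|%:R : R))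
    (\sum_(x in matched mu :&: Lead) Num.sqrt (#|good x|%:R : R)); first by exists Lead.
  by exists (~: Lead); [apply: setC_split | lra].
have [B [Bst BM Bsum]] := exists_active_sum Lead.
have [V VP leV] := exists_surplus_active Bst BM LeadP lam0.
exists V => //; apply: le_trans leV; have := sum_sqrt_degree_good.
have nu0 : 0 <= (#|matched mu|%:R : R) by [].
lra.
Qed.

End Shearer.

(** * Bisections from a maximal matching *)

Lemma exists_maximal_matching (T : finType) (g : rel T) : symmetric g -> irreflexive g ->
  exists mu : T -> T, [/\ involutive mu, forall x, x \in matched mu -> g x (mu x) &
    forall x y, x \notin matched mu -> y \notin matched mu -> ~~ g x y].
Proof.
move=> gsym girr.
pose valid (f : {ffun T -> T}) := [forall x, (f (f x) == x) && ((f x != x) ==> g x (f x))].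
have valid_id : valid [ffun x => x] by apply/forallP => x; rewrite !ffunE !eqxx.
have [f /forallP vf maxf] := arg_maxnP (fun f : {ffun T -> T} => #|matched f|) valid_id.
have fK : involutive f by move=> x; have /andP[/eqP] := vf x.
exists f; split => // [x|x y].
  by rewrite mem_matched; have /andP[_ /implyP] := vf x.
rewrite !mem_matched !negbK => /eqP fx /eqP fy; apply/negP => gxy.
have xy : x != y by apply: contraTneq gxy => ->; rewrite girr.
pose f' := [ffun z => if z == x then y else if z == y then x else f z].
have f'x : f' x = y by rewrite ffunE eqxx.
have f'y : f' y = x by rewrite ffunE eqxx eq_sym (negbTE xy).
have f'z z : z != x -> z != y -> f' z = f z.
  by move=> zx zy; rewrite ffunE (negbTE zx) (negbTE zy).
have /maxf : valid f'.
  apply/forallP => z; have [->|zx] := eqVneq z x.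
    by rewrite f'x f'y eqxx gxy implybT.
  have [->|zy] := eqVneq z y; first by rewrite f'y f'x eqxx gsym gxy implybT.
  rewrite (f'z z zx zy) f'z; first exact: vf.
    by apply: contra zx => /eqP fzx; rewrite -(fK z) fzx fx eqxx.
  by apply: contra zy => /eqP fzy; rewrite -(fK z) fzy fy eqxx.
apply/negP; rewrite -ltnNge; apply: proper_card; apply/properP; split.
  apply/subsetP => z; rewrite !mem_matched => fz.
  have zx : z != x by apply: contra fz => /eqP ->; rewrite fx.
  have zy : z != y by apply: contra fz => /eqP ->; rewrite fy.
  by rewrite f'z.
by exists x; rewrite mem_matched ?fx ?eqxx // f'x eq_sym.
Qed.

(** A maximal matching of the complete graph on [A]. *)
Lemma exists_pairing (T : finType) (A : {set T}) :
  exists pi : T -> T, [/\ involutive pi, matched pi \subset A &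
    (#|A :\: matched pi| <= 1)%N].
Proof.
have [||pi [piK piA pimax]] :=
  @exists_maximal_matching T [rel x y | [&& x != y, x \in A & y \in A]].
- by move=> x y /=; rewrite eq_sym; congr (_ && _); rewrite andbC.
- by move=> x /=; rewrite eqxx.
exists pi; split => //; first by apply/subsetP => x /piA /and3P[].
apply/card_le1_eqP => x y; rewrite !in_setD => /andP[xM xA] /andP[yM yA].
by have := pimax y x yM xM; rewrite /= xA yA !andbT negbK => /eqP.
Qed.

Section Unmatched.
Variables (R : rcfType) (T : finType) (e : rel T) (mu : T -> T).
Hypotheses (esym : symmetric e) (eirr : irreflexive e) (muK : involutive mu).
Implicit Types (V F : {set T}) (w x y : T).

Let M := matched mu.
Let W := ~: M.
Hypothesis Windep : forall x y, x \notin M -> y \notin M -> ~~ e x y.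

Definition balanced V := `|\sum_x sgn R V x| <= 1.

Lemma sum_sgn_split (pi : T -> T) V : involutive pi -> V \in split_pairs pi ->
  \sum_(x in matched pi) sgn R V x = 0.
Proof.
move=> piK VP.
have E : \sum_(x in matched pi) sgn R V x = \sum_(x in matched pi) sgn R V (pi x).
  by rewrite (reindex_inj (inv_inj piK)) /=; apply: eq_bigl => x; rewrite matched_mu.
suff : \sum_(x in matched pi) sgn R V (pi x) = - \sum_(x in matched pi) sgn R V x by lra.
by rewrite -sumrN; apply: eq_bigr => x xM; rewrite sgn_split.
Qed.

Lemma sum_sgn_matched V : V \in split_pairs mu ->
  \sum_x sgn R V x = \sum_(w in W) sgn R V w.
Proof.
move=> VP; rewrite (bigID (mem M)) /= (sum_sgn_split muK VP) add0r.
by apply: eq_bigl => x; rewrite in_setC.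
Qed.

Definition inner : rel T := [rel x y | [&& e x y, x \in M & y \in M]].

Lemma innerE x y : inner x y = [&& e x y, x \in M & y \in M].
Proof. by []. Qed.

Definition pull V w : R := \sum_(y | e w y) sgn R V y.

Lemma neighbour_unmatched w y : w \in W -> e w y -> y \in M.
Proof.
rewrite in_setC => wM ewy; apply: contraT => yM.
by have := Windep wM yM; rewrite ewy.
Qed.

Lemma surplus_unmatched V :
  surplus R e V = surplus R inner V - 2 * \sum_(w in W) sgn R V w * pull V w.
Proof.
pose G x y := sgn R V x * sgn R V y.
have E1 : \sum_(w in W) sgn R V w * pull V w = \sum_(w in W) \sum_(y | e w y) G w y.
  by apply: eq_bigr => w _; rewrite mulr_sumr.
have E2 : \sum_(w in W) \sum_(y | e w y) G w y =
          \sum_(x in M) \sum_(y | e x y && (y \in W)) G x y.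
  rewrite (exchange_big_dep (mem M)) /=; last by move=> w y; apply: neighbour_unmatched.
  apply: eq_bigr => x _; apply: eq_big => [w|w _]; first by rewrite esym andbC.
  by rewrite /G mulrC.
have E3 : \sum_x \sum_(y | e x y) G x y =
    \sum_(x in M) \sum_(y | e x y && (y \in M)) G x y +
    \sum_(x in M) \sum_(y | e x y && (y \in W)) G x y + \sum_(w in W) \sum_(y | e w y) G w y.
  rewrite (bigID (mem M)) /=; congr (_ + _); last first.
    by apply: eq_bigl => x; rewrite in_setC.
  rewrite -big_split /=; apply: eq_bigr => x _; rewrite (bigID (mem M)) /=; congr (_ + _).
  by apply: eq_bigl => y; rewrite in_setC.
have E4 : \sum_x \sum_(y | inner x y) G x y =
    \sum_(x in M) \sum_(y | e x y && (y \in M)) G x y.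
  rewrite [RHS]big_mkcond; apply: eq_bigr => x _; case: ifP => xM.
    by apply: eq_bigl => y; rewrite innerE xM.
  by apply: big_pred0 => y; rewrite innerE xM andbF.
by rewrite /surplus -/G E3 E4 E1 -E2; ring.
Qed.

Lemma eq_surplus_inner V V' : (forall x, x \in M -> (x \in V) = (x \in V')) ->
  surplus R inner V = surplus R inner V'.
Proof.
move=> VV'; congr (- _); apply: eq_bigr => x _; apply: eq_bigr => y /and3P[_ xM yM].
by rewrite /sgn !VV'.
Qed.

Lemma eq_pull V V' w : w \in W -> (forall x, x \in M -> (x \in V) = (x \in V')) ->
  pull V w = pull V' w.
Proof.
move=> wW VV'; apply: eq_bigr => y ewy.
by rewrite /sgn VV' // (neighbour_unmatched wW ewy).
Qed.

Section Greedy.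
Variable pi : T -> T.
Hypotheses (piK : involutive pi) (piW : matched pi \subset W).
Hypothesis piW1 : (#|W :\: matched pi| <= 1)%N.

(** When [w] and [pi w] have opposite signs, their joint contribution depends only on the difference
    of their pulls. *)
Definition net_pull V w : R := pull V w - (if w \in matched pi then pull V (pi w) else 0).

(** Each pair of [pi] gets opposite signs, set against its net pull. A fixed splitting [Tie] decides
    zero pulls, so every pair stays split. *)
Lemma exists_greedy V : V \in split_pairs mu -> exists2 V', balanced V' &
  surplus R inner V + \sum_(w in W) `|net_pull V w| <= surplus R e V'.
Proof.
move=> VP; have [Tie /split_pairsP TieP] := split_pairs_neq0 piK.
pose V' := [set x | if x \in M then x \in V else
  if net_pull V x == 0 then x \in Tie else net_pull V x < 0].
have V'M x : x \in M -> (x \in V') = (x \in V) by move=> xM; rewrite in_set xM.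
have V'W w : w \in W -> (w \in V') = if net_pull V w == 0 then w \in Tie else net_pull V w < 0.
  by rewrite in_setC => wM; rewrite in_set (negbTE wM).
have V'P : V' \in split_pairs mu.
  apply/split_pairsP => x xM; rewrite !V'M // ?matched_mu //.
  by have /split_pairsP := VP; apply.
have npi w : w \in matched pi -> net_pull V (pi w) = - net_pull V w.
  by move=> wpi; rewrite /net_pull matched_mu // wpi piK opprB.
have V'pi : V' \in split_pairs pi.
  apply/split_pairsP => w wpi; have wW := subsetP piW _ wpi.
  rewrite !V'W //; last by rewrite (subsetP piW) // matched_mu.
  rewrite npi // oppr_eq0; case: eqP => [_|/eqP n0]; first exact: TieP.
  by rewrite oppr_lt0 -leNgt le_eqVlt eq_sym (negbTE n0).
exists V'.
  rewrite /balanced sum_sgn_matched // (big_setID (matched pi)) /=.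
  rewrite (setIidPr piW) sum_sgn_split // add0r.
  apply: le_trans (ler_norm_sum _ _ _) _.
  rewrite (eq_bigr (fun=> 1)) => [|w _]; last by rewrite /sgn normrX normrN1 expr1n.
  by rewrite sumr_const -[_ *+ _]mulr_natl mulr1 (ler_nat _ _ 1).
rewrite surplus_unmatched (@eq_surplus_inner V' V) // lerD2l.
have pullE w : w \in W -> pull V' w = pull V w by move=> wW; apply: eq_pull.
have norm w : w \in W -> - (sgn R V' w * net_pull V w) = `|net_pull V w|.
  move=> wW; rewrite /sgn V'W //; case: eqP => [->|_]; first by rewrite mulr0 normr0 oppr0.
  case: ltrP => n0; rewrite /= ?expr0 ?expr1 ?mul1r ?mulN1r ?opprK.
    by rewrite ltr0_norm.
  by rewrite ger0_norm.
(* Symmetrising over [pi] turns the factor 2 of [surplus_unmatched] into a sum over both members of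
   each pair. *)
have sumpi : \sum_(w in W) sgn R V' w * pull V w =
             \sum_(w in W) sgn R V' (pi w) * pull V (pi w).
  rewrite (reindex_inj (inv_inj piK)) /=; apply: eq_bigl => w.
  have [wpi|] := boolP (w \in matched pi); last by rewrite mem_matched negbK => /eqP ->.
  by rewrite !(subsetP piW) // matched_mu.
have -> : - (2 * \sum_(w in W) sgn R V' w * pull V' w) =
    \sum_(w in W) - (sgn R V' w * pull V w + sgn R V' (pi w) * pull V (pi w)).
  rewrite sumrN big_split /= -sumpi (eq_bigr (fun w => sgn R V' w * pull V w)); first by ring.
  by move=> w wW; rewrite pullE.
apply: ler_sum => w wW; have := norm w wW; rewrite /net_pull.
have [wpi|wpi] := boolP (w \in matched pi).
  by rewrite sgn_split // => <-; rewrite le_eqVlt; apply/orP; left; apply/eqP; ring.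
rewrite subr0 => nw; move: wpi; rewrite mem_matched negbK => /eqP ->.
by rewrite opprD nw lerDl normr_ge0.
Qed.
Definition single w := [set y | e w y & ~~ e w (mu y)].

Hypothesis C4 : ~ contains_cycle e 4.

(** Written over one vertex of each pair of [mu], the net pull has weights [c y]. Every vertex of
    [single w] outside the neighbourhood of [pi w] makes such a weight at least 1 in absolute value,
    and by [C4] at most one vertex is excluded. *)
Lemma sum_abs_net_pull w : w \in W ->
  #|split_pairs mu|%:R * (Num.sqrt (#|single w|.-1)%:R / 4) <=
  \sum_(V in split_pairs mu) `|net_pull V w|.
Proof.
move=> wW; have [Lead /split_pairsP LeadP] := split_pairs_neq0 muK.
pose b y : R := (e w y)%:R - ((w \in matched pi) && e (pi w) y)%:R.
pose c y := b y - b (mu y).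
pose P := M :&: Lead.
have trP : transversal_set mu P.
  by move=> y; rewrite !in_setI => /andP[yM yL] _; rewrite LeadP // yL andbF.
have bM y : y \notin M -> b y = 0.
  move=> yM; have notE x : x \in W -> e x y = false.
    by rewrite in_setC => xM; apply/negbTE/Windep.
  rewrite /b notE //; have [wpi|] := boolP (w \in matched pi); last by rewrite subrr.
  by rewrite notE ?subrr // (subsetP piW) // matched_mu.
have netE V : V \in split_pairs mu -> net_pull V w = \sum_(y in P) c y * sgn R V y.
  move=> VP.
  have -> : net_pull V w = \sum_y b y * sgn R V y.
    rewrite /net_pull /pull big_mkcond /=.
    have -> : (if w \in matched pi then \sum_(y | e (pi w) y) sgn R V y else 0) =
        \sum_y ((w \in matched pi) && e (pi w) y)%:R * sgn R V y.
      case: ifP => _ /=; last by rewrite big1 // => y _; rewrite mul0r.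
      by rewrite big_mkcond; apply: eq_bigr => y _; case: (e _ _); rewrite ?mul1r ?mul0r.
    rewrite -sumrB; apply: eq_bigr => y _; rewrite mulrBl; congr (_ - _).
    by case: (e _ _); rewrite ?mul1r ?mul0r.
  rewrite (bigID (mem M)) /= [X in _ + X]big1 ?addr0; last first.
    by move=> y yM; rewrite bM // mul0r.
  rewrite (big_setID Lead) /= -/P.
  have -> : \sum_(y in P) c y * sgn R V y =
      \sum_(y in P) b y * sgn R V y + \sum_(y in P) b (mu y) * sgn R V (mu y).
    rewrite -big_split /=; apply: eq_bigr => y; rewrite in_setI => /andP[yM _].
    by rewrite (sgn_split _ VP yM) /c; ring.
  congr (_ + _); rewrite (reindex_inj (inv_inj muK)) /=; apply: eq_bigl => y.
  rewrite in_setD in_setI matched_mu //; case: (boolP (y \in M)) => yM; rewrite ?andbF //.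
  by rewrite !andbT LeadP // negbK.
have := khintchine muK c trP; rewrite (eq_bigr _ (fun V VP => congr1 Num.norm (netE V VP))).
apply: le_trans; rewrite ler_pM2l ?card_split_gt0 // ler_pM2r ?invr_gt0 //.
rewrite ler_sqrt; last by apply: sumr_ge0 => y _; apply: sqr_ge0.
pose gd := [set y in single w | ~~ ((w \in matched pi) && e (pi w) y)].
have gdM : gd \subset M.
  apply/subsetP => y; rewrite !in_set => /andP[/andP[ewy _] _].
  by rewrite -mem_matched; apply: neighbour_unmatched wW ewy.
have card_gd : (#|single w|.-1 <= #|gd|)%N.
  have := cardsID [set y | (w \in matched pi) && e (pi w) y] (single w).
  have -> : single w :\: [set y | (w \in matched pi) && e (pi w) y] = gd.
    by apply/setP => y; rewrite in_setD andbC [in RHS]in_set [in _ \notin _]in_set.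
  suff : (#|single w :&: [set y | (w \in matched pi) && e (pi w) y]| <= 1)%N.
    by move: #|gd| #|single w| => a b'; move: #|_| => c'; clear; lia.
  have [wpi|wpi] := boolP (w \in matched pi); last first.
    by rewrite (_ : _ :&: _ = set0) ?cards0 //; apply/setP => y; rewrite !inE andbF.
  apply: leq_trans (card_common_neighbours esym eirr C4 (x := w) (y := pi w) _); last first.
    by rewrite eq_sym -mem_matched.
  by apply/subset_leq_card/subsetP => y; rewrite !inE => /andP[/andP[-> _] ->].
have c2 y : (y \in gd)%:R + (mu y \in gd)%:R <= c y ^+ 2.
  rewrite !in_set -!(mem_matched pi) muK /c /b.
  case: (e w y); case: (e w (mu y)); case: (_ && e (pi w) y);
    case: (_ && e (pi w) (mu y)); rewrite /= ?andbF ?andbT /= ?mulr0n ?mulr1n; nra.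
apply: (@le_trans _ _ (#|gd|)%:R); first by rewrite ler_nat.
apply: le_trans (ler_sum _ (fun y _ => c2 y)).
rewrite big_split /= -!natr_sum -natrD.
have -> : (#|gd| = \sum_(y in M) (y \in gd))%N.
  rewrite -sum1_card big_mkcond [RHS]big_mkcond /=; apply: eq_bigr => y _.
  by case: (boolP (y \in gd)) => [/(subsetP gdM) -> //|_]; case: (y \in M).
rewrite (big_setID Lead) /= -/P ler_nat leq_add2l.
rewrite (reindex_inj (inv_inj muK)) /= (eq_bigl (mem P)) // => y.
rewrite -[RHS]/(y \in M :&: Lead) in_setD in_setI matched_mu //.
by case: (boolP (y \in M)) => yM; rewrite ?andbF // !andbT LeadP // negbK.
Qed.

Definition double w := [set y | e w y & e w (mu y)].

(** If [#|single w|] is at least 2, losing one vertex costs at most a factor 2 under the root;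
    otherwise degree at least 2 forces [double w] to be nonempty, and it absorbs the loss. *)
Lemma sqrt_degree_single w : (2 <= degree e w)%N ->
  Num.sqrt (degree e w)%:R <= 2 * Num.sqrt (#|single w|.-1)%:R + 2 * #|double w|%:R :> R.
Proof.
have -> : degree e w = (#|single w| + #|double w|)%N.
  have := cardsID [set y | e w (mu y)] [set y | e w y].
  have -> : [set y | e w y] :&: [set y | e w (mu y)] = double w.
    by apply/setP => y; rewrite !inE.
  have -> : [set y | e w y] :\: [set y | e w (mu y)] = single w.
    by apply/setP => y; rewrite !inE andbC.
  rewrite addnC => ->; apply: eq_card => y; by rewrite !inE.
move: #|single w| #|double w| => r t d2.
have s0 := sqrtr_ge0 ((r.-1)%:R : R); have t0 : 0 <= (t%:R : R) by [].
have [r2|r1] := leqP 2 r.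
  have := sqrt_add_nat R r t; suff : Num.sqrt (r%:R : R) <= 2 * Num.sqrt (r.-1)%:R by lra.
  have -> : (2 : R) = Num.sqrt (4%:R).
    by rewrite (_ : 4%:R = (2 : R) ^+ 2) ?sqrtr_sqr ?normr_nat // -natrX.
  by rewrite -sqrtrM ?ler0n // ler_sqrt ?mulr_ge0 ?ler0n // -natrM ler_nat; lia.
have t1 : 1 <= (t%:R : R) by rewrite (ler_nat R 1); lia.
have := sqrt_add_nat R r t; suff : Num.sqrt (r%:R : R) <= 1 by lra.
by rewrite -[leRHS]sqrtr1 ler_sqrt ?ler01 // (ler_nat R _ 1); lia.
Qed.

(* By [C4] a matched edge lies in at most one triangle. *)
Lemma sum_double : (forall x, x \in M -> e x (mu x)) ->
  (\sum_(w in W) #|double w| <= #|M|)%N.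
Proof.
move=> emu; under eq_bigr do rewrite -sum1_card.
rewrite (exchange_big_dep (mem M)) /=; last first.
  by move=> w y wW; rewrite in_set => /andP[ewy _]; apply: neighbour_unmatched ewy.
rewrite -[X in (_ <= X)%N]sum1_card; apply: leq_sum => y yM; rewrite sum1_card.
apply: leq_trans (card_common_neighbours esym eirr C4 (x := y) (y := mu y) _); last first.
  by rewrite eq_sym -mem_matched.
apply/subset_leq_card/subsetP => w; rewrite -topredE /= !in_set => /andP[_ /andP[wy wmy]].
by rewrite esym wy esym.
Qed.

(** Random signs on the matching give [#|M|] on average and greedy placement adds the net pulls.
    Part of [#|M|] pays for the triangles on matching edges. *)
Lemma exists_surplus_unmatched : (forall x, x \in M -> e x (mu x)) -> min_degree_ge e 2 ->
  exists2 V, balanced V &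
  #|M|%:R / 2 + 8^-1 * \sum_(w in W) Num.sqrt (degree e w)%:R <= surplus R e V.
Proof.
move=> emu deg2.
have isym : symmetric inner.
  by move=> x y; rewrite !innerE esym; congr (_ && _); rewrite andbC.
have iirr : irreflexive inner by move=> x; rewrite innerE eirr.
have imu x : x \in M -> inner x (mu x) by move=> xM; rewrite innerE emu // matched_mu // xM.
have [||V VP leV] := @exists_ge_mean R _ (split_pairs mu)
  (fun V => surplus R inner V + \sum_(w in W) `|net_pull V w|)
  (#|M|%:R + 4^-1 * \sum_(w in W) Num.sqrt (#|single w|.-1)%:R).
- by have [V VP] := split_pairs_neq0 muK; apply/card_gt0P; exists V.
- have [Lead LeadP] := split_pairs_neq0 muK.
  (* With [B] empty the local majority changes nothing, so this is the mean for plain random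
     signs. *)
  have := @sum_surplus_local_majority R T inner mu isym iirr muK imu set0 Lead (fun=> set0).
  rewrite set0I big_set0 mulr0 addr0 (eq_bigr (surplus R inner)); last first.
    by move=> V _; congr surplus; apply/setP => x; rewrite !inE.
  move=> base; rewrite big_split /= base; last first.
  + by move=> x x' y; rewrite inE.
  + by move=> x y; rewrite inE.
  + by move=> x y; rewrite inE.
  + by move=> x y; rewrite inE.
  + exact: LeadP.
  + exact: sub0set.
  + by move=> x; rewrite !inE.
  rewrite mulrDr lerD2l exchange_big /=.
  have -> : #|split_pairs mu|%:R * (4^-1 * \sum_(w in W) Num.sqrt (#|single w|.-1)%:R) =
      \sum_(w in W) #|split_pairs mu|%:R * (Num.sqrt (#|single w|.-1)%:R / 4) :> R.
    by rewrite -mulr_sumr -mulr_suml; ring.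
  by apply: ler_sum => w; apply: sum_abs_net_pull.
have [V' balV' leV'] := exists_greedy VP.
exists V' => //; apply: le_trans leV'; apply: le_trans leV.
have : \sum_(w in W) Num.sqrt (degree e w)%:R <=
    2 * \sum_(w in W) Num.sqrt (#|single w|.-1)%:R + 2 * #|M|%:R :> R.
  apply: (@le_trans _ _ (\sum_(w in W) (2 * Num.sqrt (#|single w|.-1)%:R + 2 * #|double w|%:R))).
    by apply: ler_sum => w _; apply: sqrt_degree_single.
  rewrite big_split /= -!mulr_sumr lerD2l ler_wpM2l // -natr_sum ler_nat.
  exact: sum_double.
have : 0 <= (#|M|%:R : R) by [].
lra.
Qed.

(** The local majority runs inside [M] with no penalty on [W], since placing [W] greedily afterwards
    loses nothing. *)
Lemma exists_surplus_inner : (forall x, x \in M -> e x (mu x)) -> ~ contains_cycle e 6 ->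
  exists2 V, balanced V &
  #|M|%:R / 2 + 256^-1 * \sum_(x in M) Num.sqrt (degree inner x)%:R <= surplus R e V.
Proof.
move=> emu C6.
have sub l : contains_cycle inner l -> contains_cycle e l.
  move=> [p [sp /andP[cp up]]]; exists p; split => //; rewrite /ucycle up andbT.
  by apply: sub_cycle cp => x y; rewrite innerE => /and3P[].
have [|||||V VP leV] := @exists_surplus_sqrt R T inner mu _ _ muK _ _ _ 0 (lexx 0).
- by move=> x y; rewrite !innerE esym; congr (_ && _); rewrite andbC.
- by move=> x; rewrite innerE eirr.
- by move=> x xM; rewrite innerE emu // matched_mu // xM.
- by move=> /sub.
- by move=> /sub.
have [V' balV' leV'] := exists_greedy VP.
exists V' => //; apply: le_trans leV'; move: leV; rewrite !mul0r !subr0 => /le_trans; apply.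
by rewrite lerDl; apply: sumr_ge0.
Qed.

End Greedy.

(** Discard a vertex of largest [d] repeatedly; the average never increases. *)
Lemma exists_cheap_subset (A : {set T}) (d : T -> nat) q : (q <= #|A|)%N ->
  exists F : {set T}, [/\ F \subset A, #|F| = q &
    (#|A| * \sum_(x in F) d x <= q * \sum_(x in A) d x)%N].
Proof.
have [n] := ubnP #|A|; elim: n A => // n IHn A leA qA.
have [->|qA'] := eqVneq q #|A|; first by exists A.
have /card_gt0P[a0 a0A] : (0 < #|A|)%N by move: qA qA'; clear; lia.
have [a aA amax] := arg_maxnP d a0A.
have {}aA : a \in A by [].
have cA : #|A| = #|A :\ a|.+1 by rewrite (cardsD1 a A) aA.
have [||F [FA cF leF]] := IHn (A :\ a).
- by move: leA; rewrite cA; clear; lia.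
- by move: qA qA'; rewrite cA; clear; lia.
exists F; split => //; first by apply: subset_trans FA _; apply: subsetDl.
have sumle : (\sum_(x in A) d x <= #|A| * d a)%N.
  by rewrite -sum_nat_const; apply: leq_sum => x; apply: amax.
move: sumle leF; rewrite (big_setD1 a aA) /= cA.
have [c0|c0] := posnP #|A :\ a|.
  have -> : F = set0 by apply/eqP; rewrite -cards_eq0 cF; move: qA qA'; rewrite cA c0; clear; lia.
  by rewrite big_set0 !muln0.
move: c0 (\sum_(x in A :\ a) d x)%N (\sum_(x in F) d x)%N (d a) => c0 S SF da s1 s2.
rewrite -(leq_pmul2l c0); move: s1 s2 c0; move: #|_| => c; clear => s1 s2 c0.
apply: (@leq_trans (c.+1 * (q * S))); first by rewrite mulnCA leq_mul2l s2 orbT.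
rewrite mulnCA [(c * _)%N]mulnCA leq_mul2l; apply/orP; right.
by rewrite mulSn mulnDr; move: s1; rewrite mulSn; lia.
Qed.

Lemma surplus_setC V : surplus R e (~: V) = surplus R e V.
Proof.
congr (- _); apply: eq_bigr => x _; apply: eq_bigr => y _.
by rewrite /sgn !in_setC; case: (x \in V); case: (y \in V); rewrite /= ?expr0 ?expr1; ring.
Qed.

Lemma sgn_setC V x : sgn R (~: V) x = - sgn R V x.
Proof. by rewrite /sgn in_setC; case: (x \in V); rewrite /= ?expr0 ?expr1 ?opprK. Qed.

(** As [W] is independent, flipping [w] changes the surplus by [4 * (sgn R V w * pull V w)],
    additively over [F]. *)
Lemma surplus_flip_unmatched F V : F \subset W ->
  surplus R e V - 4 * (\sum_(w in F) degree e w)%:R <= surplus R e (flip F V).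
Proof.
move=> FW; rewrite !surplus_unmatched.
have agree x : x \in M -> (x \in flip F V) = (x \in V).
  move=> xM; rewrite in_set; have : x \notin F.
    by apply/negP => /(subsetP FW); rewrite in_setC xM.
  by move=> /negbTE ->; rewrite addbF.
rewrite (eq_surplus_inner agree).
have -> : \sum_(w in W) sgn R (flip F V) w * pull (flip F V) w =
    \sum_(w in W) sgn R V w * pull V w - 2 * \sum_(w in F) sgn R V w * pull V w.
  rewrite (big_setID F) /= (setIidPr FW) [in RHS](big_setID F) /= (setIidPr FW).
  have e1 : \sum_(w in F) sgn R (flip F V) w * pull (flip F V) w =
      - \sum_(w in F) sgn R V w * pull V w.
    rewrite -sumrN; apply: eq_bigr => w wF; rewrite sgn_flip wF expr1 mulN1r mulNr.
    by rewrite (eq_pull (subsetP FW _ wF) agree).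
  have e2 : \sum_(w in W :\: F) sgn R (flip F V) w * pull (flip F V) w =
      \sum_(w in W :\: F) sgn R V w * pull V w.
    apply: eq_bigr => w; rewrite in_setD => /andP[/negbTE wF wW].
    by rewrite sgn_flip wF expr0 mul1r (eq_pull wW agree).
  by rewrite e1 e2; ring.
have : - (\sum_(w in F) degree e w)%:R <= \sum_(w in F) sgn R V w * pull V w.
  rewrite natr_sum -sumrN; apply: ler_sum => w wF.
  have abs1 x : `|sgn R V x| = 1 by rewrite /sgn normrX normrN1 expr1n.
  suff : `|sgn R V w * pull V w| <= (degree e w)%:R by rewrite ler_norml => /andP[].
  rewrite normrM abs1 mul1r; apply: le_trans (ler_norm_sum _ _ _) _.
  by rewrite (eq_bigr _ (fun y _ => abs1 y)) sumr_const.
lra.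
Qed.

(* The unmatched vertices get independent signs, so their imbalance is about
   [sqrt #|W|]; it is repaired by flipping the cheapest ones on the larger side. *)
Lemma exists_surplus_matched : (forall x, x \in M -> e x (mu x)) ->
  ~ contains_cycle e 4 -> ~ contains_cycle e 6 -> (0 < #|W|)%N ->
  exists2 V, balanced V &
  #|M|%:R / 2 + 256^-1 * \sum_(x in M) Num.sqrt (degree e x)%:R
    - 4 * (\sum_(w in W) degree e w)%:R / Num.sqrt #|W|%:R <= surplus R e V.
Proof.
move=> emu C4 C6 W0; set m2 := (\sum_(w in W) degree e w)%N.
(* The price of one unit of imbalance: half as many vertices are flipped, each costs 4 times its
   degree, and the cheapest ones on the larger side have average degree at most [2 * m2 / #|W|]. *)
pose lam : R := 4 * m2%:R / #|W|%:R.
have lam0 : 0 <= lam by rewrite !mulr_ge0 ?invr_ge0.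
have [V0 V0P leV0] := exists_surplus_sqrt esym eirr muK emu C4 C6 lam0.
have {V0 V0P leV0}[V [VP maj leV]] : exists V, [/\ V \in split_pairs mu,
    (#|W :\: V| <= #|W :&: V|)%N &
    #|M|%:R / 2 + 256^-1 * \sum_(x in M) Num.sqrt (degree e x)%:R
      - lam * Num.sqrt #|W|%:R <= surplus R e V - lam * `|\sum_(w in W) sgn R V w|].
  have [le|lt] := leqP #|W :\: V0| #|W :&: V0|; first by exists V0.
  (* Complementing keeps the surplus and makes [V] the larger side on [W]. *)
  exists (~: V0); split; first exact: setC_split.
    by rewrite setDE setCK -setDE ltnW.
  rewrite surplus_setC; under [X in _ - lam * `|X|]eq_bigr do rewrite sgn_setC.
  by rewrite sumrN normrN.
have sumW : \sum_(w in W) sgn R V w = #|W :&: V|%:R - #|W :\: V|%:R.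
  rewrite (big_setID V) /=; congr (_ + _).
    rewrite -sumr_const; apply: eq_bigr => w; rewrite in_setI => /andP[_ wV].
    by rewrite /sgn wV.
  rewrite -sumr_const -sumrN; apply: eq_bigr => w; rewrite in_setD => /andP[wV _].
  by rewrite /sgn wV.
have cW : (#|W :&: V| + #|W :\: V| = #|W|)%N by apply: cardsID.
(* Flipping [q] vertices lowers the imbalance by [2 * q] and leaves 0 or 1. *)
pose q := (#|W :&: V| - #|W :\: V|)./2.
have [|F [FA cF leF]] := @exists_cheap_subset (W :&: V) (degree e) q.
  by rewrite /q; move: maj; clear; lia.
have FW : F \subset W by apply: subset_trans FA _; apply: subsetIl.
exists (flip F V).
  have VP' : flip F V \in split_pairs mu.
    apply/split_pairsP => x xM; have out y : y \in M -> y \in F = false.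
      by move=> yM; apply/negP => /(subsetP FW); rewrite in_setC yM.
    rewrite !in_set !out ?matched_mu // !addbF.
    by have /split_pairsP := VP; apply.
  rewrite /balanced sum_sgn_matched //.
  have -> : \sum_(w in W) sgn R (flip F V) w = \sum_(w in W) sgn R V w - 2 * q%:R.
    rewrite -cF (big_setID F) /= (setIidPr FW) [in RHS](big_setID F) /= (setIidPr FW).
    have e1 : \sum_(w in F) sgn R (flip F V) w = - #|F|%:R.
      rewrite -sumr_const -sumrN; apply: eq_bigr => w wF; rewrite sgn_flip wF expr1 mulN1r.
      by have := subsetP FA _ wF; rewrite in_setI /sgn => /andP[_ ->].
    have e2 : \sum_(w in F) sgn R V w = #|F|%:R.
      rewrite -sumr_const; apply: eq_bigr => w wF.
      by have := subsetP FA _ wF; rewrite in_setI /sgn => /andP[_ ->].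
    have e3 : \sum_(w in W :\: F) sgn R (flip F V) w = \sum_(w in W :\: F) sgn R V w.
      apply: eq_bigr => w; rewrite in_setD => /andP[/negbTE wF _].
      by rewrite sgn_flip wF expr0 mul1r.
    by rewrite e1 e2 e3; ring.
  rewrite sumW -natrB // -natrM -natrB; last by rewrite /q; clear; lia.
  by rewrite normr_nat (ler_nat R _ 1) /q; clear; lia.
apply: le_trans (surplus_flip_unmatched V FW).
have W0R : 0 < (#|W|%:R : R) by rewrite ltr0n.
have lamE : lam * Num.sqrt #|W|%:R = 4 * m2%:R / Num.sqrt #|W|%:R.
  rewrite /lam -{1}(sqr_sqrtr (ltW W0R)); field.
  by rewrite sqrtr_eq0 -ltNge.
rewrite -lamE; apply: le_trans leV _; rewrite lerD2l lerN2 sumW.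
rewrite -natrB // normr_nat /lam mulrAC ler_pdivlMr // -mulrA -[leRHS]mulrA ler_wpM2l //.
rewrite -!natrM ler_nat.
have subm2 : (\sum_(w in W :&: V) degree e w <= m2)%N.
  by rewrite /m2 [in X in (_ <= X)%N](big_setID V) /= leq_addr.
set SF := (\sum_(w in F) degree e w)%N in leF *.
apply: (@leq_trans (2 * (#|W :&: V| * SF))).
  by rewrite mulnC mulnA leq_mul2r; apply/orP; right; move: maj cW; clear; lia.
apply: (@leq_trans (2 * (q * m2))).
  by rewrite leq_mul2l /=; apply: leq_trans leF _; rewrite leq_mul2l subm2 orbT.
by rewrite mulnA mulnC leq_mul2l; apply/orP; right; rewrite /q; clear; lia.
Qed.

End Unmatched.

(** * Counting edges *)

Section Counting.
Variables (T : finType) (e : rel T).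
Hypotheses (esym : symmetric e) (eirr : irreflexive e).

Lemma sum_degree_edges : (\sum_x degree e x = 2 * #|edges e|)%N.
Proof.
pose up := [set p : T * T | e p.1 p.2 & (enum_rank p.1 < enum_rank p.2)%N].
pose dn := [set p : T * T | e p.1 p.2 & (enum_rank p.2 < enum_rank p.1)%N].
have -> : (\sum_x degree e x = #|up| + #|dn|)%N.
  transitivity #|[set p : T * T | e p.1 p.2]|.
    rewrite -sum1_card.
    under eq_bigr => x _ do rewrite /degree -sum1_card.
    by rewrite pair_big_dep /=; apply: eq_bigl => p; rewrite !inE.
  rewrite -cardsUI [X in (_ + X)%N](_ : _ = 0%N) ?addn0.
    apply: eq_card => -[x y]; rewrite !inE /=; have [exy|] := boolP (e x y) => //=.
    case: ltngtP => // /val_inj /enum_rank_inj xy.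
    by rewrite xy eirr in exy.
  by apply: eq_card0 => p; rewrite !inE; case: (e _ _) => //=; case: ltngtP.
have -> : #|dn| = #|up|.
  pose sw (p : T * T) := (p.2, p.1).
  have swK : involutive sw by case.
  rewrite -(card_imset _ (inv_inj swK)); apply: eq_card => p; rewrite -[p]swK.
  by rewrite (mem_imset _ _ (inv_inj swK)) !inE esym.
have -> : #|edges e| = #|up|; last by rewrite addnn mul2n.
pose f (p : T * T) := [set p.1; p.2].
rewrite -(card_in_imset (f := f) (D := mem up)).
  apply: eq_card => E; rewrite inE; apply/existsP/imsetP => [[x /existsP[y /andP[exy /eqP ->]]]|].
    have [lt|gt|/val_inj/enum_rank_inj xy] := ltngtP (enum_rank x) (enum_rank y).
    - by exists (x, y); rewrite // inE exy.
    - by exists (y, x); rewrite ?inE /= 1?esym ?exy // /f setUC.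
    - by rewrite xy eirr in exy.
  move=> [[x y]]; rewrite inE /= => /andP[exy _] ->; exists x; apply/existsP; exists y.
  by rewrite exy eqxx.
move=> [x y] [x' y']; rewrite !inE /= => /andP[_ lt] /andP[_ lt'] /setP E.
have := E x; have := E y; have := E x'; rewrite !inE !eqxx ?orbT /=.
move=> /orP[/eqP xx|/eqP xy].
  rewrite xx => /ssrfun.esym /orP[/eqP yx|/eqP ->] // _; by rewrite yx ltnn in lt.
move=> /ssrfun.esym /orP[/eqP yx'|/eqP yy'] /ssrfun.esym /orP[/eqP xx'|/eqP xy'].
- by rewrite yx' xx' ltnn in lt.
- by move: lt lt'; rewrite yx' xy' => lt lt'; have := ltn_trans lt lt'; rewrite ltnn.
- by rewrite xy yy' in lt'; move: lt'; rewrite xx' xy yy' ltnn.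
- by rewrite xy' yy' ltnn in lt.
Qed.

Lemma cut_size_crossing (V : {set T}) :
  cut_size e V (~: V) = #|[set p : T * T | [&& e p.1 p.2, p.1 \in V & p.2 \notin V]]|.
Proof.
pose f (p : T * T) := [set p.1; p.2].
rewrite -(card_in_imset (f := f)); last first.
  move=> [x y] [x' y']; rewrite !inE /= => /and3P[_ xV yV] /and3P[_ xV' yV'] /setP E.
  have := E x; have := E y; rewrite !inE !eqxx ?orbT /=.
  move=> /ssrfun.esym /orP[/eqP yx|/eqP ->]; first by rewrite yx xV' in yV.
  by move=> /ssrfun.esym /orP[/eqP ->//|/eqP xy]; rewrite xy (negbTE yV') in xV.
apply: eq_card => E; rewrite in_set; apply/andP/imsetP => [[]|[[x y]]].
  rewrite inE => /existsP[x0 /existsP[y0 /andP[exy0 /eqP E0]]].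
  move=> /exists_inP[x xV /exists_inP[y yV /eqP Exy]]; exists (x, y) => //.
  have xy_neq : x != y by apply: contraTneq xV => ->; move: yV; rewrite inE.
  move: yV; rewrite !inE xV => -> /=; rewrite andbT.
  have /setP EE : [set x; y] = [set x0; y0] by rewrite -Exy.
  have := EE x; have := EE y; rewrite !inE !eqxx orbT /=.
  move=> /ssrfun.esym /orP[/eqP yx|/eqP yy] /ssrfun.esym /orP[/eqP xx|/eqP xy].
  - by rewrite yx xx eqxx in xy_neq.
  - by rewrite yx xy esym.
  - by rewrite yy xx.
  - by rewrite yy xy eqxx in xy_neq.
rewrite inE /= => /and3P[exy xV yV] ->; split.
  by rewrite inE; apply/existsP; exists x; apply/existsP; exists y; rewrite exy eqxx.
by apply/exists_inP; exists x => //; apply/exists_inP; exists y; rewrite ?inE.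
Qed.

Lemma cut_size_surplus (R : rcfType) (V : {set T}) :
  (cut_size e V (~: V))%:R = #|edges e|%:R / 2 + surplus R e V / 4 :> R.
Proof.
pose cr (x y : T) : R := ((x \in V) && (y \notin V))%:R.
have sE x y : sgn R V x * sgn R V y = 1 - 2 * (cr x y + cr y x).
  by rewrite /sgn /cr; case: (x \in V); case: (y \in V); rewrite /= ?expr0 ?expr1; ring.
have cE : \sum_x \sum_(y | e x y) cr x y = (cut_size e V (~: V))%:R.
  rewrite cut_size_crossing -sum1_card natr_sum.
  rewrite pair_big_dep /= big_mkcond [RHS]big_mkcond /=; apply: eq_bigr => -[x y] _ /=.
  by rewrite inE /cr /=; case: (e x y) => //=; case: (_ && _).
have cE' : \sum_x \sum_(y | e x y) cr y x = (cut_size e V (~: V))%:R.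
  rewrite -cE (exchange_big_dep predT) //=; apply: eq_bigr => x _.
  by apply: eq_bigl => y; rewrite esym.
have dE : \sum_x \sum_(y | e x y) (1 : R) = 2 * #|edges e|%:R.
  rewrite -[2]/(2%:R) -natrM -sum_degree_edges natr_sum; apply: eq_bigr => x _.
  by rewrite sumr_const.
have : surplus R e V = - (2 * #|edges e|%:R - 2 * ((cut_size e V (~: V))%:R
    + (cut_size e V (~: V))%:R)).
  rewrite /surplus -dE -{1}cE -cE' -big_split /= mulr_sumr -sumrB; congr (- _).
  apply: eq_bigr => x _; rewrite -big_split /= mulr_sumr -sumrB.
  by apply: eq_bigr => y _; rewrite sE.
lra.
Qed.

(** A vertex with [d] neighbours in [B] sees [d * (d - 1)] ordered pairs of them, and
    [d <= 1 + d * (d - 1)]. Without 4-cycles each pair is seen at most once. *)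
Lemma sum_unmatched_degree (A B : {set T}) : ~ contains_cycle e 4 ->
  (\sum_(x in A) #|[set w in B | e x w]| <= #|A| + #|B| ^ 2)%N.
Proof.
move=> C4; pose P x := [set p in setX B B | [&& p.1 != p.2, e x p.1 & e x p.2]].
have le1 x : (#|[set w in B | e x w]| <= 1 + #|P x|)%N.
  have [->|/set0Pn[w0 w0N]] := eqVneq [set w in B | e x w] set0; first by rewrite cards0.
  rewrite (cardsD1 w0) w0N leq_add2l.
  have pinj : injective (pair w0 : T -> T * T) by move=> a b [].
  rewrite -(card_imset _ pinj); apply/subset_leq_card/subsetP => _ /imsetP[w wN ->].
  by move: w0N wN; rewrite !inE /= => /andP[-> ->] /and3P[ww0 -> ->]; rewrite eq_sym ww0.
apply: (@leq_trans (\sum_(x in A) (1 + #|P x|))); first by apply: leq_sum.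
rewrite big_split /= sum1_card leq_add2l.
under eq_bigr => x _ do rewrite -sum1_card.
rewrite (exchange_big_dep (mem (setX B B))) /=; last first.
  by move=> x p _; rewrite in_set => /andP[].
have -> : (#|B| ^ 2 = #|setX B B|)%N by rewrite cardsX expnS expn1.
rewrite -[X in (_ <= X)%N]sum1_card; apply: leq_sum => -[w w'] _; rewrite sum1_card.
have [->|ww'] := eqVneq w w'.
  by rewrite eq_card0 // => x; rewrite -topredE /= !inE /= eqxx !andbF.
apply: leq_trans (card_common_neighbours esym eirr C4 ww').
apply/subset_leq_card/subsetP => x; rewrite -topredE /= !inE /=.
by rewrite (esym w) (esym w') => /andP[_ /and4P[_ _ -> ->]].
Qed.

(** Here [Phi] sends [d] to the square root of [D * d], which is at least [d] when [d <= D]. *)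
Lemma sum_sqrt_degenerate (R : rcfType) (D : nat) :
  (forall U : {set T}, U != set0 -> exists2 v, v \in U & (degree_in e U v <= D)%N) ->
  #|edges e|%:R <= Num.sqrt D%:R * \sum_x Num.sqrt (degree e x)%:R :> R.
Proof.
move=> degen.
have dE x : degree_in e [set: T] x = degree e x by apply: eq_card => y; rewrite !inE.
have sumT (F : T -> R) : \sum_(v in [set: T]) F v = \sum_v F v.
  by apply: eq_bigl => v; rewrite inE.
have := @degenerate_sum_bound T e esym eirr R
  (fun d => Num.sqrt D%:R * Num.sqrt d%:R) [set: T].
rewrite natr_sum !sumT; under eq_bigr do rewrite dE.
under [X in _ -> _ -> is_true (_ <= _ * X)]eq_bigr do rewrite dE.
rewrite -natr_sum sum_degree_edges -mulr_sumr natrM ler_pM2l //.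
apply.
  by move=> a b ab; rewrite ler_wpM2l ?sqrtr_ge0 // ler_sqrt ?ler0n // ler_nat.
move=> S _ /degen[v vS dv]; exists v => //.
set d := degree_in e S v in dv *.
have {1}-> : (d%:R : R) = Num.sqrt d%:R * Num.sqrt d%:R by rewrite -expr2 sqr_sqrtr.
by rewrite ler_wpM2r ?sqrtr_ge0 // ler_sqrt ?ler0n // ler_nat.
Qed.

(** Otherwise [U] has at least [q ^ k] vertices, each of degree at least [q], and the degree sum
    exceeds [2 * #|edges e|]. *)
Lemma even_cycle_free_degenerate (k q : nat) : ~ contains_cycle e (2 * k) ->
  (0 < k)%N -> (0 < q)%N -> (2 * #|edges e| < q ^ k.+1)%N ->
  forall U : {set T}, U != set0 ->
  exists2 v, v \in U & (degree_in e U v <= 4 * k * (q + 3))%N.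
Proof.
move=> C2k k0 q0 mq U U0; apply/exists_inP; apply: contraT; rewrite negb_exists_in.
move=> /forall_inP big.
have Udeg v : v \in U -> (4 * k * (q + 3) <= degree_in e U v)%N.
  by move=> /big; rewrite -ltnNge => /ltnW.
have Uq := even_cycle_free_min_degree esym eirr C2k k0 q0 U0 Udeg.
have : (#|U| * (4 * k * (q + 3)) <= 2 * #|edges e|)%N.
  rewrite -sum_degree_edges -sum_nat_const.
  rewrite [X in (_ <= X)%N](bigID (mem U)) /=; apply: leq_trans (leq_addr _ _).
  apply: leq_sum => v /Udeg /leq_trans; apply.
  by apply/subset_leq_card/subsetP => y; rewrite !inE => /andP[].
move: mq Uq; rewrite expnS; move: (q ^ k)%N #|U| #|edges e| => Q u m; clear -k0.
move=> lt Qu le; have qle : (q <= 4 * k * (q + 3))%N by nia.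
have : (q * Q <= u * (4 * k * (q + 3)))%N by rewrite mulnC leq_mul.
lia.
Qed.

End Counting.

(** * Choosing among the three bisections *)

(** Take the least [q] with [2 * m < q ^ k.+1]. Minimality bounds [q.-1 ^ k.+1], and
    [q + 3 <= 5 * q.-1] gives the factor [20 * k]. *)
Lemma exists_root_bound (k m : nat) : (0 < k)%N -> (0 < m)%N ->
  exists q, [/\ (0 < q)%N, (2 * m < q ^ k.+1)%N &
    ((4 * k * (q + 3)) ^ k.+1 <= (20 * k) ^ k.+1 * (2 * m))%N].
Proof.
move=> k0 m0; have ex_q : exists q, (2 * m < q ^ k.+1)%N.
  by exists (2 * m).+1; rewrite -[X in (X < _)%N]expn1 (leq_trans _ (leq_pexp2l _ (ltn0Sn k))) // expn1.
case: (ex_minnP ex_q) => q mq qmin.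
have q2 : (1 < q)%N.
  by case: q mq {qmin} => [|[|//]]; rewrite ?exp0n ?exp1n //; move: m0; clear; lia.
have q1 : (q.-1 ^ k.+1 <= 2 * m)%N.
  by rewrite leqNgt; apply/negP => /qmin; move: q2; clear; lia.
exists q; split => //; first exact: ltnW.
apply: (@leq_trans ((20 * k) ^ k.+1 * q.-1 ^ k.+1)); last by rewrite leq_mul2l q1 orbT.
rewrite -expnMn leq_exp2r //; have : (q + 3 <= 5 * q.-1)%N by move: q2; clear; lia.
by clear; nia.
Qed.

(** Here [nu] and [s] are the numbers of matched and unmatched vertices, [m2] is the degree sum of
    the unmatched ones, and [S1], [SM], [S2] sum square roots of degrees: inside the matched set, of
    matched, and of unmatched vertices. One of these quantities is of order [y = m / Num.sqrt D], or
    the graph has bounded size. *)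
Lemma large_surplus_cases (R : rcfType) (h C nu s m m2 D S1 S2 SM QA QB QC : R) :
  32 * 256 <= h -> 1 <= nu -> 0 <= s -> 0 <= m -> 1 <= D -> 1 <= C -> 0 <= S1 -> 0 <= S2 ->
  D ^+ 4 <= C * m -> m2 <= 2 * m -> 0 <= m2 ->
  m <= Num.sqrt D * (SM + S2) -> SM <= S1 + nu + s ^+ 2 ->
  nu / 2 + 256^-1 * S1 <= QA -> nu / 2 + 8^-1 * S2 <= QB ->
  (0 < s -> nu / 2 + 256^-1 * SM - 4 * m2 / Num.sqrt s <= QC) ->
  let m0 := 4 * h ^+ 4 * (4 * C * h ^+ 4) ^+ 3 in
  let x := (1024 * m0)^-1 * (m / Num.sqrt D) in
  x <= QA \/ x <= QB \/ x <= QC.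
Proof.
move=> h0 nu1 s0 m_ge0 D1 C1 S10 S20 D4 m2m m20 mS SMle QAle QBle QCle m0 x.
set r := Num.sqrt D; have r1 : 1 <= r by rewrite -[leLHS]sqrtr1 ler_sqrt; lra.
have rp : 0 < r by apply: lt_le_trans r1.
have rD : r ^+ 2 = D by rewrite sqr_sqrtr // (le_trans ler01).
have h1 : 1 <= h by lra.
have h4 : 1 <= h ^+ 4 by apply: exprn_ege1.
have Ch1 : 1 <= 4 * C * h ^+ 4 by nra.
have m01 : 1 <= m0.
  rewrite /m0; have : 1 <= (4 * C * h ^+ 4) ^+ 3 by apply: exprn_ege1.
  by nra.
set y := m / r; have y0 : 0 <= y by rewrite divr_ge0 // ltW.
have xy : x <= y / 1024.
  have i0 : 0 <= m0^-1 by rewrite invr_ge0; lra.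
  have i1 : m0^-1 <= 1 by rewrite invf_le1 // (lt_le_trans ltr01).
  by rewrite /x invfM -/y; nra.
have yS : y <= SM + S2 by rewrite ler_pdivrMr // mulrC.
have [S2big|S2small] := lerP (y / 4) S2; first by right; left; lra.
have [sbig|ssmall] := lerP (h * r) (Num.sqrt s).
  right; right; have sp : 0 < s.
    by rewrite -sqrtr_gt0; apply: lt_le_trans sbig; apply: mulr_gt0 => //; lra.
  apply: le_trans (QCle sp).
  (* The repair costs at most [8 * m / (h * r)], and [h] is at least 8 times 1024; the gain from
     [SM] exceeds three times this. *)
  have : 4 * m2 / Num.sqrt s <= y / 1024.
    rewrite ler_pdivrMr ?sqrtr_gt0 //.
    have : m <= y / (32 * 256) * Num.sqrt s.
      have -> : m = y * r by rewrite /y; field; rewrite gt_eqF.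
      have : y * (h * r) <= y * Num.sqrt s by rewrite ler_wpM2l.
      have : y * r * (32 * 256) <= y * r * h by rewrite ler_wpM2l // mulr_ge0 // ltW.
      by lra.
    by lra.
  by lra.
have [S1big|S1small] := lerP (y / 4) S1; first by left; lra.
have [nubig|nusmall] := lerP (y / 4) nu; first by right; left; lra.
(* In the remaining case [s ^+ 2] is large while [s] is at most of order [D]. So [m] is at most of
   order [D ^+ 3], and [D ^+ 4 <= C * m] bounds both [D] and [m]; then [1 <= nu] is gain enough. *)
have s2 : y / 4 <= s ^+ 2 by lra.
have sD : s <= h ^+ 2 * D.
  rewrite -(sqr_sqrtr s0) -rD -exprMn; apply: lerXn2r; rewrite ?nnegrE ?sqrtr_ge0 ?ltW //.
  by apply: mulr_gt0 => //; lra.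
have s2D : s ^+ 2 <= h ^+ 4 * D ^+ 2.
  rewrite -[4%N]/(2 * 2)%N exprM -exprMn; apply: lerXn2r; rewrite ?nnegrE //.
  by apply: mulr_ge0; [apply: sqr_ge0 | lra].
have rleD : r <= D by rewrite -rD expr2 ler_peMl // ltW.
have D0 : 0 < D by lra.
have mD : m <= 4 * h ^+ 4 * D ^+ 3.
  have -> : m = y * r by rewrite /y; field; rewrite gt_eqF.
  apply: (@le_trans _ _ (4 * (h ^+ 4 * D ^+ 2) * D)); last by rewrite le_eqVlt; apply/orP; left; apply/eqP; ring.
  by apply: ler_pM => //; [apply: ltW | lra].
have DE : D <= 4 * C * h ^+ 4.
  rewrite -(ler_pM2r (exprn_gt0 3 D0)) -exprS; apply: le_trans D4 _.
  have : C * m <= C * (4 * h ^+ 4 * D ^+ 3) by rewrite ler_wpM2l //; lra.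
  by lra.
have mm0 : m <= m0.
  apply: le_trans mD _; rewrite /m0 ler_wpM2l //; first by lra.
  by apply: lerXn2r; rewrite ?nnegrE //; lra.
right; left; have ym : y <= m by rewrite ler_pdivrMr // ler_peMr.
have : x <= 1024^-1.
  rewrite /x invfM -mulrA -[leRHS]mulr1 ler_wpM2l ?invr_ge0 // mulrC -/y.
  by rewrite ler_pdivrMr ?mul1r; lra.
by lra.
Qed.

(** The bound keeps [D] explicit, so only its square root enters here; the power of the number of
    edges is extracted at the end. *)
Lemma exists_large_surplus (R : rcfType) (k : nat) : (3 <= k)%N ->
  exists2 c : R, 0 < c & forall (T : finType) (e : rel T),
    symmetric e -> irreflexive e -> (0 < #|T|)%N -> min_degree_ge e 2 ->
    ~ contains_cycle e 4 -> ~ contains_cycle e 6 -> ~ contains_cycle e (2 * k) ->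
    exists D V, [/\ (0 < D)%N, (D ^ k.+1 <= (20 * k) ^ k.+1 * (2 * #|edges e|))%N,
      balanced R V & c * (#|edges e|%:R / Num.sqrt D%:R) <= surplus R e V].
Proof.
move=> k3.
pose h : R := 32 * 256; pose C : R := ((20 * k) ^ k.+1 * 2)%:R.
have C1 : 1 <= C by rewrite (ler_nat R 1) muln_gt0 expn_gt0 muln_gt0; move: k3; clear; lia.
exists ((1024 * (4 * h ^+ 4 * (4 * C * h ^+ 4) ^+ 3))^-1).
  by rewrite invr_gt0 !(mulr_gt0, exprn_gt0) // (lt_le_trans ltr01).
move=> T e esym eirr T0 deg2 C4 C6 C2k.
have [mu [muK emu Windep]] := exists_maximal_matching esym eirr.
have [x0 _] := card_gt0P T0.
have [y0 ex0y0] : exists y, e x0 y.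
  have /card_gt0P[y] : (0 < degree e x0)%N by apply: leq_trans (deg2 x0).
  by rewrite inE; exists y.
have nu0 : (0 < #|matched mu|)%N.
  apply/card_gt0P; have [xM|xM] := boolP (x0 \in matched mu); first by exists x0.
  exists y0; apply: contraT => yM; by have := Windep _ _ xM yM; rewrite ex0y0.
have m0 : (0 < #|edges e|)%N.
  have := sum_degree_edges esym eirr; rewrite (bigD1 x0) //=.
  by have := deg2 x0; clear; lia.
have [q [q0 mq Dq]] := exists_root_bound (ltnW (ltnW k3)) m0.
set D := (4 * k * (q + 3))%N in Dq.
have D0 : (0 < D)%N by rewrite /D; move: k3; clear; nia.
have degen := even_cycle_free_degenerate esym eirr C2k (ltnW (ltnW k3)) q0 mq.
have mS := sum_sqrt_degenerate esym eirr R degen.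
have [pi [piK piW piW1]] := exists_pairing (~: matched mu).
have [VA balA leA] := exists_surplus_inner R esym eirr muK Windep piK piW piW1 C4 emu C6.
have [VB balB leB] := exists_surplus_unmatched R esym eirr muK Windep piK piW piW1 C4 emu deg2.
have [VC balC leC] : exists2 V, balanced R V & (0 < #|~: matched mu|%:R :> R ->
  #|matched mu|%:R / 2 + 256^-1 * \sum_(x in matched mu) Num.sqrt (degree e x)%:R
    - 4 * (\sum_(w in ~: matched mu) degree e w)%:R / Num.sqrt #|~: matched mu|%:R
  <= surplus R e V).
  (* Without unmatched vertices the third bound is vacuous, and [VB] merely serves as a balanced
     set. *)
  have [W0|W0] := posnP #|~: matched mu|; first by exists VB; rewrite // W0 ltxx.
  by have [V balV leV] := exists_surplus_matched R esym eirr muK Windep emu C4 C6 W0; exists V.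
have := @large_surplus_cases R h C #|matched mu|%:R #|~: matched mu|%:R #|edges e|%:R
  (\sum_(w in ~: matched mu) degree e w)%:R D%:R
  (\sum_(x in matched mu) Num.sqrt (degree (inner e mu) x)%:R)
  (\sum_(w in ~: matched mu) Num.sqrt (degree e w)%:R)
  (\sum_(x in matched mu) Num.sqrt (degree e x)%:R)
  (surplus R e VA) (surplus R e VB) (surplus R e VC).
have sge0 (A : {set T}) (F : T -> nat) : 0 <= \sum_(x in A) Num.sqrt (F x)%:R :> R.
  by apply: sumr_ge0 => x _; apply: sqrtr_ge0.
case.
- exact: lexx.
- by rewrite (ler_nat R 1).
- exact: ler0n.
- exact: ler0n.
- by rewrite (ler_nat R 1).
- exact: C1.
- exact: sge0.
- exact: sge0.
(* Since [k] is at least 3, [D ^ 4] is at most [D ^ k.+1]. *)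
- rewrite -natrX /C -natrM ler_nat -mulnA; apply: leq_trans Dq.
  by apply: leq_pexp2l => //; move: k3; clear; lia.
- rewrite -[2]/(2%:R) -natrM ler_nat -(sum_degree_edges esym eirr).
  by rewrite [X in (_ <= X)%N](bigID (mem (~: matched mu))) /= leq_addr.
- exact: ler0n.
- apply: le_trans mS _; rewrite ler_wpM2l ?sqrtr_ge0 //.
  rewrite (bigID (mem (matched mu))) /= lerD2l le_eqVlt; apply/orP; left; apply/eqP.
  by apply: eq_bigl => x; rewrite in_setC.
(* The neighbours of a matched vertex in the unmatched set are taken out of the root;
   [sum_unmatched_degree] bounds their total. *)
- rewrite -addrA -natrX -natrD.
  have := sum_unmatched_degree esym eirr (matched mu) (~: matched mu) C4.
  rewrite -(ler_nat R) => bound; apply: le_trans (lerD (lexx _) bound).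
  rewrite natr_sum -big_split /=; apply: ler_sum => x xM; apply: le_trans (sqrt_add_nat _ _ _).
  rewrite ler_sqrt ?ler0n // ler_nat.
  apply: leq_trans (_ : #|[set y | inner e mu x y] :|: [set w in ~: matched mu | e x w]| <= _)%N.
    apply/subset_leq_card/subsetP => y; rewrite [y \in _]inE => exy.
    rewrite in_setU in_set innerE exy xM in_set in_setC exy andbT.
    by case: (y \in matched mu).
  apply: leq_trans (leq_card_setU _ _).1 _; rewrite leq_add2r; apply: eq_leq.
  by apply: eq_card => y; rewrite !inE.
- exact: leA.
- exact: leB.
- exact: leC.
- by move=> leQ; exists D, VA.
- by case=> leQ; [exists D, VB | exists D, VC].
Qed.

(** * From balanced signs and square roots to bisections and real powers *)

Lemma balanced_bisection (R : rcfType) (T : finType) (V : {set T}) :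
  balanced R V -> bisection V (~: V)%SET.
Proof.
move=> bal; split.
- exact: setUCr.
- by rewrite -setI_eq0 setICr.
suff sumE : \sum_x sgn R V x = (#|V|%:Z - #|~: V|%:Z)%:~R.
  by move: bal; rewrite /balanced sumE -intr_norm (ler_int R _ 1).
rewrite intrB -!pmulrn (bigID (mem V)) /=; congr (_ + _).
  by rewrite (eq_bigr (fun=> 1)) ?sumr_const // => x xV; rewrite /sgn xV.
rewrite (eq_bigr (fun=> -1)) => [|x xV]; last by rewrite /sgn xV.
by rewrite sumr_const mulNrn; congr (- (_ *+ _)); apply: eq_card => x; rewrite !inE.
Qed.

From mathcomp Require Import all_classical all_reals all_analysis.

(** With [a = 1 / (2k + 2)] the square root of [D] is [D ^+ k.+1] to the power [a], hence at most
    [C]^ a * m%:R [^ a]. The exponents [b] and [a] add up to 1. *)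
Lemma powR_degenerate (R : realType) (k D m : nat) (C : R) : (0 < m)%N -> (0 < D)%N ->
  0 <= C -> D%:R ^+ k.+1 <= C * m%:R ->
  m%:R `^ ((2 * k + 1)%:R / (2 * k + 2)%:R) <=
  C `^ ((2 * k + 2)%:R^-1) * (m%:R / Num.sqrt D%:R).
Proof.
move=> m0 D0 C0 DC; set a := (2 * k + 2)%:R^-1; set b := _ * a.
have K0 : ((2 * k + 2)%:R : R) != 0 by rewrite pnatr_eq0; lia.
have a0 : 0 <= a by rewrite invr_ge0.
have mR : 0 < (m%:R : R) by rewrite ltr0n.
have r0 : 0 < Num.sqrt (D%:R : R) by rewrite sqrtr_gt0 ltr0n.
have ba : b + a = 1.
  by rewrite /b -{2}[a]mul1r -mulrDl natr1 -addn1 -addnA divff.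
have sqrtD : Num.sqrt (D%:R : R) <= C `^ a * m%:R `^ a.
  rewrite -powRM ?ler0n //.
  have -> : Num.sqrt (D%:R : R) = (D%:R ^+ k.+1) `^ a.
    rewrite -{2}(sqr_sqrtr (ler0n R D)) -exprM -powR_mulrn ?sqrtr_ge0 // -powRrM.
    have -> : (2 * k.+1)%N%:R * a = 1 :> R.
      by rewrite (_ : 2 * k.+1 = 2 * k + 2)%N ?divff //; lia.
    by rewrite powRr1 ?sqrtr_ge0.
  by apply: ge0_ler_powR; rewrite ?nnegrE ?exprn_ge0 ?mulr_ge0.
rewrite mulrA ler_pdivlMr //.
apply: (@le_trans _ _ (m%:R `^ b * (C `^ a * m%:R `^ a))).
  by rewrite ler_wpM2l ?powR_ge0.
rewrite mulrCA -powRD; last by apply/implyP => _; rewrite gt_eqF.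
by rewrite ba powRr1.
Qed.

Theorem theorem1p4 (R : realType) (k : nat) (hk : (3 <= k)%N) :
  exists c : R, 0 < c /\
    forall (T : finType) (e : rel T),
      simple_graph e ->
      connected_graph e ->
      min_degree_ge e 2 ->
      ~ contains_cycle e 4 ->
      ~ contains_cycle e 6 ->
      ~ contains_cycle e (2 * k) ->
      exists V0 V1 : {set T},
        bisection V0 V1 /\
        #|edges e|%:R / 2%:R
          + c * #|edges e|%:R `^ ((2 * k + 1)%:R / (2 * k + 2)%:R)
        <= (cut_size e V0 V1)%:R.
Proof.
have [c c0 large] := exists_large_surplus R hk.
pose C : R := ((20 * k) ^ k.+1 * 2)%:R.
have C0 : 0 < C by rewrite ltr0n muln_gt0 expn_gt0 muln_gt0; move: hk; clear; lia.
pose p := C `^ ((2 * k + 2)%:R^-1); have p0 : 0 < p by apply: powR_gt0.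
(* The 4 converts the surplus into cut edges, and [p] is the constant lost in [powR_degenerate]. *)
exists (c / 4 / p); split; first by rewrite !divr_gt0.
move=> T e [esym eirr] [T0 _] deg2 C4 C6 C2k.
have [D [V [D0 Dle bal leV]]] := large T e esym eirr T0 deg2 C4 C6 C2k.
exists V, (~: V)%SET; split; first exact: balanced_bisection bal.
rewrite (cut_size_surplus esym eirr) lerD2l.
have m0 : (0 < #|edges e|)%N.
  by rewrite lt0n; apply: contraTneq Dle => ->; rewrite !muln0 -ltnNge expn_gt0 D0.
have H : #|edges e|%:R `^ ((2 * k + 1)%:R / (2 * k + 2)%:R) <=
    p * (#|edges e|%:R / Num.sqrt D%:R).
  by apply: powR_degenerate => //; rewrite -natrX -natrM ler_nat -mulnA.
rewrite mulrAC ler_pdivrMr //; apply: (@le_trans _ _ (c / 4 * (p * (#|edges e|%:R / Num.sqrt D%:R)))).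
  by rewrite ler_wpM2l // divr_ge0 // ltW.
have : p * (c * (#|edges e|%:R / Num.sqrt D%:R)) <= p * surplus R e V.
  by rewrite ler_wpM2l // ltW.
move: (_ / _) (surplus R e V) => x y; lra.
Qed.
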